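(* Let $X,Y,D,d,\lambda,T,u,f,\mu_X,\nu,H$ be as described in the context. Assume that $H\in L^{1+\delta}(\lambda)$ locally for some $\delta>0$, and let $\kappa>1$ be conjugate to $1+\delta$, i.e. $\frac1{1+\delta}+\frac1\kappa=1$. Assume further: (a) there exist constants $C_1>0$, $\beta>0$, $\gamma'$ with $0<\gamma'<\frac{\beta}{D}$, and an increasing function $g$ with $g(n)\approx n^{D\gamma'}$ such that, if $$E_n^X:=\left\{x\in X:\ d_X(T^jx,x)<\tfrac1n\ \text{ for some integer } 1\le j\le g(n)\right\},$$ then $\mu_X(E_n^X)<\frac{C_1}{n^\beta}$ for all $n\ge 1$; (b) there exist $0<\hat\alpha\le 1$, a constant $C_2>0$ and a function $\Theta$ such that for all H\''older continuous $\Upsilon:X\times Y\to\mathbb{R}$ with exponent $\hat\alpha$, all $\Psi\in L^\infty(\nu)$ and all $j\ge1$, $$\left|\int (\Psi\circ f^j)\,\Upsilon\,d\nu-\int\Upsilon\,d\nu\int\Psi\,d\nu\right|\le C_2\,\Theta(j)\,\|\Psi\|_\infty\,\|\Upsilon\|_{C^{\hat\alpha}},$$ where $\Theta(j)\le j^{-\alpha}$ and $$\alpha>\frac{\frac1D\left(1+D\kappa\left(\frac32-\frac1\kappa\right)\right)+\frac32}{\min\{\gamma',\frac12\}}.$$ Then for $\nu$-a.e. $(x_0,\theta_0)\in X\times Y$ and for every $v\in\mathbb{R}$, with $u_n=v+\frac1D\log n$, $$\lim_{n\to\infty}\nu\left(Z_n^{(x_0,\theta_0)}<u_n\right)=e^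{-H(x_0,\theta_0)e^{-Dv}}.$$
   Context: $X$ is a compact $N$-dimensional manifold with (Riemannian) metric $d_X$; $Y$ is a compact connected $M$-dimensional manifold with (Riemannian) metric $d_Y$ (boundary is allowed, e.g. intervals). $D=M+N$, and $X\times Y$ carries the metric $d((x_1,\theta_1),(x_2,\theta_2))=\sqrt{d_X(x_1,x_2)^2+d_Y(\theta_1,\theta_2)^2}$. $\lambda_X,\lambda_Y$ are Lebesgue measures on $X,Y$ and $\lambda=\lambda_X\times\lambda_Y$; they are normalized (by constant factors) so that $\lambda(B_r(p))/r^D\to1$ as $r\to0$ for $\lambda$-a.e. $p$, where $B_r(p)$ is the $d$-ball of radius $r$. $T:X\to X$ and $u:X\times Y\to Y$ are measurable, and $f:X\times Y\to X\times Y$, $f(x,\theta)=(Tx,u(x,\theta))$, is the $Y$-skew-extension of $T$ by $u$. $T$ has an ergodic invariant probability measure $\mu_X$ with support $X$. $f$ preserves a probability measure $\nu$ which is absolutely continuous with respect to $\mu_X\times\lambda_Y$ with integrable density, and $\nu$ has a density $H=d\nu/d\lambda$ with respect to $\lambda$ that is locally in $L^p(\lambda)$ for some $p>1$. A function $\Upsilon$ on $X\times Y$ is H\''older of exponent $\zeta$ if $|\Upsilon(p)-\Upsilon(q)|\le K d(p,q)^\zeta$ for some constant $K$ and all $p,q$; its norm is $\|\Upsilon\|_{C^\zeta}=\sup_p|\Upsilon(p)|+\sup_{p\ne q}\frac{|\Upsilon(p)-\Upsilon(q)|}{d(p,q)^\zeta}$. For a point $(x_0,\theta_0)\in X\times Y$,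 $\Phi(x,\theta)=-\log d((x,\theta),(x_0,\theta_0))$ and $Z_n^{(x_0,\theta_0)}=\max(\Phi,\Phi\circ f,\dots,\Phi\circ f^n)$. $g(n)\approx n^{D\gamma'}$ means that $g(n)$ and $n^{D\gamma'}$ are comparable up to positive multiplicative constants. *)

(* Defs.v *)
From HB Require Import structures.
From mathcomp Require Import all_boot all_order all_algebra.
From mathcomp Require Import all_classical all_reals all_analysis.
Set Implicit Arguments.
Unset Strict Implicit.
Unset Printing Implicit Defensive.
Import Order.TTheory GRing.Theory Num.Theory.
Import numFieldNormedType.Exports.
Local Open Scope classical_set_scope.
Local Open Scope ring_scope.

HB.mixin Record isBorel (R : numDomainType) (d : measure_display) T
    & Metric R T & Measurable d T := {
  measurable_borel : (@measurable d T) = <<s [set U : set T | open U] >>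
}.

#[short(type="borelMetricType")]
HB.structure Definition BorelMetric (R : numDomainType) (d : measure_display) :=
  {T of Metric R T & Measurable d T & isBorel R d T}.

Section euclidean.
Context {R : realType}.

Fixpoint class_C (k n : nat) (U : set 'rV[R]_n) (F : 'rV[R]_n -> R) : Prop :=
  (forall p, U p -> {for p, continuous F}) /\
  match k with
  | 0 => True
  | k'.+1 => forall i : 'I_n,
      (forall p, U p -> derivable F p (delta_mx 0 i)) /\
      class_C k' U (fun p => 'D_(delta_mx 0 i) F p)
  end.

Definition smooth (n : nat) (U : set 'rV[R]_n) (F : 'rV[R]_n -> R) : Prop :=
  forall k, class_C k U F.

(* S need not be open: at each of its points F has a smooth local extension. *)
Definition smooth_on (n : nat) (S : set 'rV[R]_n) (F : 'rV[R]_n -> R) : Prop :=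
  forall p, S p -> exists (O : set 'rV[R]_n) (G : 'rV[R]_n -> R),
    [/\ open O, O p, smooth O G & forall q, O q -> S q -> G q = F q].

(* Local model of an n-manifold with boundary; a point for n = 0. *)
Definition halfspace (n : nat) : set 'rV[R]_n :=
  [set p | forall i : 'I_n, i = 0%N :> nat -> 0 <= p 0 i].

(* Row vectors: the differential of tau at p is v |-> v *m jac tau p. *)
Definition jac (m n : nat) (tau : 'rV[R]_m -> 'rV[R]_n) (p : 'rV[R]_m) :
    'M[R]_(m, n) :=
  \matrix_(i, j) 'D_(delta_mx 0 i) (fun q => tau q 0 j) p.

(* Integral over R^n of a nonnegative Borel function with respect to
   n-dimensional Lebesgue measure, as an iterated integral (Tonelli). *)
Fixpoint lebesgue_int (n : nat) : ('rV[R]_n -> \bar R) -> \bar R :=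
  match n with
  | 0 => fun F => F 0
  | m.+1 => fun F => (\int[lebesgue_measure]_t
      lebesgue_int (fun p : 'rV[R]_m =>
        F (row_mx (const_mx t : 'rV[R]_1) p : 'rV[R]_m.+1)))%E
  end.

Definition class_C1_curve (n : nat) (s : R -> 'rV[R]_n) : Prop :=
  (forall t, derivable s t 1) /\ continuous (derive1 s).

End euclidean.

Record chart (R : realType) (n : nat) (X : topologicalType) := Chart {
  cdom : set X ;
  cmap : X -> 'rV[R]_n ;
  cinv : 'rV[R]_n -> X ;
  cdom_open : open cdom ;
  cmapK : forall x, cdom x -> cinv (cmap x) = x ;
  cimg_open : exists2 O : set 'rV[R]_n,
    open O & cmap @` cdom = O `&` @halfspace R n ;
  cmap_continuous : {within cdom, continuous cmap} ;
  cinv_continuous : {within cmap @` cdom, continuous cinv}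
}.

Definition cimg (R : realType) (n : nat) (X : topologicalType)
  (c : chart R n X) : set 'rV[R]_n := cmap c @` cdom c.

(* metric c p is the Gram matrix of the metric at the point with coordinates p
   in the chart c; its values off cimg c are irrelevant. *)
Record riemannian (R : realType) (n : nat) (X : topologicalType) := Riemannian {
  atlas : set (chart R n X) ;
  metric : chart R n X -> 'rV[R]_n -> 'M[R]_n ;
  atlas_cover : forall x, exists2 c, atlas c & cdom c x ;
  metric_sym : forall c p, atlas c -> cimg c p -> (metric c p)^T = metric c p ;
  metric_pos : forall c p (v : 'rV[R]_n), atlas c -> cimg c p -> v != 0 ->
    0 < (v *m metric c p *m v^T) 0 0 ;
  metric_smooth : forall c i j, atlas c ->
    smooth_on (cimg c) (fun p => metric c p i j) ;
  (* tau extends the transition map from c1 to c2 near p *)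
  transition : forall c1 c2 p, atlas c1 -> atlas c2 ->
    (cmap c1 @` (cdom c1 `&` cdom c2)) p ->
    exists (O : set 'rV[R]_n) (tau : 'rV[R]_n -> 'rV[R]_n),
      [/\ open O, O p, (forall j, smooth O (fun q => tau q 0 j)) &
        forall q, O q -> (cmap c1 @` (cdom c1 `&` cdom c2)) q ->
          tau q = cmap c2 (cinv c1 q) /\
          metric c1 q = jac tau q *m metric c2 (tau q) *m (jac tau q)^T]
}.

Section riemannian_distance_volume.
Context {R : realType} {n : nat}.

Definition arc_length (X : topologicalType) (G : riemannian R n X)
    (c : chart R n X) (s : R -> 'rV[R]_n) : R :=
  \int[lebesgue_measure]_(t in `[0, 1])
    Num.sqrt ((derive1 s t *m metric G c (s t) *m (derive1 s t)^T) 0 0).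

(* path_length G x y L: a piecewise C^1 curve of length L joins x to y.  The
   curve is a concatenation of finitely many arcs, each inside one chart. *)
Inductive path_length (X : topologicalType) (G : riemannian R n X) (y : X) :
    X -> R -> Prop :=
| path_nil : path_length G y y 0
| path_cons (c : chart R n X) (s : R -> 'rV[R]_n) (L : R) :
    atlas G c -> class_C1_curve s ->
    (forall t, 0 <= t <= 1 -> cimg c (s t)) ->
    path_length G y (cinv c (s 1)) L ->
    path_length G y (cinv c (s 0)) (arc_length G c s + L).

(* X may be disconnected; the distance between points of different components
   is only constrained by mdist being a metric for the topology of X. *)
Definition riemannian_distance (X : metricType R) (G : riemannian R n X) :
    Prop :=
  forall x y : X, path_length G y x !=set0 ->
    mdist x y = inf (path_length G y x).

(* lam is a constant multiple of the Riemannian volume. *)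
Definition lebesgue_on d (X : borelMetricType R d) (G : riemannian R n X)
    (lam : set X -> \bar R) : Prop :=
  exists2 k : R, 0 < k & forall (c : chart R n X) (B : set X),
    atlas G c -> measurable B -> B `<=` cdom c ->
    lam B = (k%:E * lebesgue_int (fun p =>
      (\1_(cmap c @` B) p * Num.sqrt (\det (metric G c p)))%:E))%E.

End riemannian_distance_volume.

Section dynamics.
Context {R : realType}.

Definition invariant_measure d (T : measurableType d) (mu : set T -> \bar R)
    (f : T -> T) : Prop :=
  forall A, measurable A -> mu (f @^-1` A) = mu A.

Definition ergodic d (T : measurableType d) (mu : set T -> \bar R)
    (f : T -> T) : Prop :=
  forall A, measurable A -> f @^-1` A = A -> mu A = 0%E \/ mu A = 1%E.

Definition full_support (T : topologicalType) (mu : set T -> \bar R) : Prop :=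
  forall U, open U -> U !=set0 -> (0 < mu U)%E.

Definition has_density d (T : measurableType d) (nu : set T -> \bar R)
    (lam : {measure set T -> \bar R}) (h : T -> R) : Prop :=
  lam.-integrable setT (EFin \o h) /\
  forall A, measurable A -> nu A = (\int[lam]_(x in A) (h x)%:E)%E.

Definition skew_ext (X Y : Type) (T : X -> X) (u : X * Y -> Y) (q : X * Y) :
    X * Y :=
  (T q.1, u q).

End dynamics.

Section product_space.
Context {R : realType} {d1 d2 : measure_display}.
Context {X : borelMetricType R d1} {Y : borelMetricType R d2}.
Implicit Types (p q : X * Y).

Definition pdist p q : R :=
  Num.sqrt (mdist p.1 q.1 ^+ 2 + mdist p.2 q.2 ^+ 2).

Definition pball p (r : R) : set (X * Y) := [set q | pdist p q < r].

Definition locally_Lp (lam : {measure set (X * Y) -> \bar R}) (r : R)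
    (h : X * Y -> R) : Prop :=
  forall p, exists U : set (X * Y), [/\ open U, U p &
    (\int[lam]_(q in U) (`|h q| `^ r)%:E < +oo)%E].

Definition hoelder_continuous (zeta : R) (F : X * Y -> R) : Prop :=
  exists K : R, forall p q, `|F p - F q| <= K * pdist p q `^ zeta.

Definition hoelder_norm (zeta : R) (F : X * Y -> R) : R :=
  sup [set `|F p| | p in setT] +
  sup [set w | exists p q, p <> q /\ w = `|F p - F q| / pdist p q `^ zeta].

(* Extended-real valued, so that the value at q = p is +oo. *)
Definition Phi p q : \bar R := (- lne (pdist q p)%:E)%E.

Definition Zmax (f : X * Y -> X * Y) p (n : nat) q : \bar R :=
  \big[maxe/-oo%E]_(i < n.+1) Phi p (iter i f q).

End product_space.

Definition short_return (R : realType) (X : metricType R) (T : X -> X)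
    (g : nat -> R) (n : nat) : set X :=
  [set x | exists j : nat,
    [/\ (1 <= j)%N, j%:R <= g n & mdist (iter j T x) x < n%:R^-1]].

(* Main.v *)
From HB Require Import structures.
Require Import Defs.
From mathcomp Require Import all_boot all_order all_algebra.
From mathcomp Require Import all_classical all_reals all_analysis.
From mathcomp Require Import measurable_realfun ess_sup_inf ring lra.
Import Order.TTheory GRing.Theory Num.Theory.
Import numFieldNormedType.Exports.
Set Implicit Arguments.
Unset Strict Implicit.
Unset Printing Implicit Defensive.
Local Open Scope classical_set_scope.
Local Open Scope ring_scope.

(* Write U_n for the closed ball around p of radius r_n = e^{-v} n^{-1/D}; the
   event Z_n < u_n says that the orbit avoids U_n at the times 0, ..., n.
   Cut time into about sqrt n blocks of length s = sqrt n, separated by gaps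
   t = n^b with b < min (gamma', 1/2).  If n nu(U_n) -> H(p) e^{-Dv}, if visits
   to U_n decorrelate after time t, and if n sum_{1 <= j < s} nu(U_n, f^-j U_n)
   tends to 0, then the avoidance probability tends to exp(-H(p) e^{-Dv}).
   - The first limit is the differentiation of nu = H lambda along balls.  The
     Vitali covering argument only needs lambda(B_r(p)) <= 2 r^D for small r, which
     the normalization of lambda gives almost everywhere.
   - For decorrelation, 1_{U_n} is replaced by a Lipschitz bump supported in the
     ball of radius r_n + w_n, w_n = n^{-1/4} r_n.  As
     n (nu(B_{r_n + w_n}) - nu(B_{r_n})) -> 0 by differentiation, no estimate of
     the volume of annuli is needed.
   - A return to U_n within time t forces the X-coordinate into E^X_{2^k} with
     2^k comparable to n^{1/D}.  Ergodicity makes muX the X-marginal of nu, so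
     nu (E^X_{2^k} x Y) is at most C1 2^{-k beta}; the weak-type maximal
     inequality and Borel-Cantelli bound the share of U_n in that set for almost
     every p. *)

(** * Coverings and the maximal inequality *)

Section separable_metric.
Context {R : realType} {Z : Type}.
Variable rho : Z -> Z -> R.

Definition separable_metric : Prop :=
  [/\ forall p, rho p p = 0,
      forall p q, rho p q = rho q p,
      forall p q s, rho p s <= rho p q + rho q s &
      exists e : nat -> Z, forall p r, 0 < r -> exists n, rho p (e n) < r].

Definition mball (p : Z) (r : R) : set Z := [set q | rho p q < r].

Definition mopen (U : set Z) : Prop :=
  forall p, U p -> exists2 r, 0 < r & mball p r `<=` U.

Hypothesis rhoP : separable_metric.

Lemma vitali_finite (I : eqType) (c : I -> Z) (r : I -> R) (s : seq I) :
  exists t : seq I, [/\ uniq t, {subset t <= s},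
    trivIset [set` t] (fun i => mball (c i) (r i)) &
    forall i, i \in s -> exists2 j, j \in t &
      mball (c i) (r i) `<=` mball (c j) (3 * r j)].
Proof.
have [rxx rsym rtri _] := rhoP.
pose LE i j := r i <= r j.
have LEtr : transitive LE by move=> x y z; exact: le_trans.
wlog : s / sorted LE s => [hw|].
  have [t [ut ts tt tc]] := hw _ (sort_sorted (fun x y => le_total (r x) (r y)) s).
  exists t; split => // [x /ts|i]; first by rewrite mem_sort.
  by rewrite -(mem_sort LE); exact: tc.
have self i : mball (c i) (r i) `<=` mball (c i) (3 * r i).
  move=> x xi; apply: (lt_le_trans xi).
  have : 0 < r i; last by lra.
  by apply: le_lt_trans xi; have := rtri (c i) x (c i); rewrite rxx (rsym x); lra.
elim: s => [_|i s IH /= pis]; first by exists [::].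
have [t [ut ts tt tc]] := IH (path_sorted pis).
have le_is j : j \in s -> r i <= r j.
  by move: pis; rewrite path_sortedE // => /andP[/allP h _] /h.
have [[j jt [y [yi yj]]]|nI] := pselect (exists2 j, j \in t &
    (mball (c i) (r i) `&` mball (c j) (r j)) !=set0).
  exists t; split => // [x /ts|k]; first by rewrite inE => ->; rewrite orbT.
  rewrite inE => /predU1P[->|/tc //]; exists j => // x xi; rewrite /mball /=.
  have := le_is _ (ts _ jt); move: xi yi yj; rewrite /mball /=.
  have := rtri (c j) y x; have := rtri y (c i) x; rewrite (rsym y (c i)); lra.
have [iit|iit] := boolP (i \in t).
  exists t; split => // [x /ts|k]; first by rewrite inE => ->; rewrite orbT.
  by rewrite inE => /predU1P[->|/tc //]; exists i.
exists (i :: t); split => //.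
- by rewrite /= iit.
- by move=> x; rewrite !inE => /predU1P[->|/ts ->]; rewrite ?eqxx ?orbT.
- move=> j k /=; rewrite !inE => /predU1P[->|jt] /predU1P[->|kt] //.
  + by move=> ne0; exfalso; apply: nI; exists k.
  + by rewrite setIC => ne0; exfalso; apply: nI; exists j.
  + exact: tt.
- move=> k; rewrite inE => /predU1P[->|/tc[j jt h]].
    by exists i; rewrite ?mem_head.
  by exists j => //; rewrite inE jt orbT.
Qed.

Lemma lindelof (A : set Z) (r : Z -> R) : (forall p, A p -> 0 < r p) ->
  A !=set0 -> exists c : nat -> Z, (forall n, A (c n)) /\
    A `<=` \bigcup_n mball (c n) (r (c n)).
Proof.
have [rxx rsym rtri [e de]] := rhoP.
move=> r0 [a0 Aa0].
pose P (ik : nat * nat) a := A a /\ mball (e ik.1) ik.2.+1%:R^-1 `<=` mball a (r a).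
pose g ik := if pselect (exists a, P ik a) is left h then projT1 (cid h) else a0.
exists (fun n => if unpickle n is Some ik then g ik else a0); split.
  move=> n; case: unpickle => // ik; rewrite /g.
  by case: pselect => // h; case: (projT2 (cid h)).
move=> a Aa.
have [k /= hk] : exists k : nat, k.+1%:R^-1 < r a / 2.
  have [k hk] := ltr_add_invr (y := 0 : R) (x := r a / 2) (divr_gt0 (r0 _ Aa) (ltr0Sn _ 1)).
  by exists k; rewrite add0r in hk.
have k0 : 0 < k.+1%:R^-1 :> R by rewrite invr_gt0.
have [i hi] := de a _ k0.
have Pa : P (i, k) a.
  split => // x; rewrite /mball /= => xi.
  apply: le_lt_trans (rtri _ (e i) _) _. move: xi hi hk; set w := k.+1%:R^-1. lra.
exists (pickle (i, k)) => //; rewrite pickleK /g; case: pselect => [h|]; last first.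
  by move=> /(_ (ex_intro _ a Pa)).
case: (projT2 (cid h)) => _; apply.
by rewrite /mball /= rsym.
Qed.

End separable_metric.

Section weak_type.
Context {R : realType} d {Z : measurableType d}.
Variable rho : Z -> Z -> R.
Hypothesis rhoP : separable_metric rho.
Hypothesis mB : forall p r, measurable (mball rho p r).

Lemma measurable_mopen (U : set Z) : mopen rho U -> measurable U.
Proof.
move=> oU; have [->|/set0P U0] := eqVneq U set0; first exact: measurable0.
have [r hr] : {r : Z -> R & forall p, U p -> 0 < r p /\ mball rho p (r p) `<=` U}.
  apply: (@choice _ _ (fun p r => U p -> 0 < r /\ mball rho p r `<=` U)) => p.
  have [Up|nUp] := pselect (U p); last by exists 0.
  by have [r r0 h] := oU p Up; exists r.
have [c [cU UE]] := lindelof rhoP (fun p Up => (hr p Up).1) U0.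
suff -> : U = \bigcup_n mball rho (c n) (r (c n)) by apply: bigcupT_measurable => *; exact: mB.
apply/seteqP; split => // x [n _]; exact: (hr _ (cU n)).2.
Qed.

Variables (lam sig : {measure set Z -> \bar R}).
Local Open Scope ereal_scope.

Lemma weak_type (A : set Z) (K : R) : (0 <= K)%R ->
  (forall p, A p -> exists2 r : R, (0 < r)%R &
    lam (mball rho p (3 * r)) <= K%:E * sig (mball rho p r)) ->
  exists S, [/\ measurable S, A `<=` S & lam S <= K%:E * sig setT].
Proof.
move=> K0 hA; have [rxx rsym rtri _] := rhoP.
have [->|/set0P A0] := eqVneq A set0.
  by exists set0; split => //; rewrite measure0 mule_ge0.
have [r hr] : {r : Z -> R & forall p, A p -> (0 < r p)%R /\
    lam (mball rho p (3 * r p)) <= K%:E * sig (mball rho p (r p))}.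
  apply: (@choice _ _ (fun p r => A p -> (0 < r)%R /\
    lam (mball rho p (3 * r)) <= K%:E * sig (mball rho p r))) => p.
  have [Up|nUp] := pselect (A p); last by exists 0%R.
  by have [s r0 h] := hA p Up; exists s.
have [c [cA AE]] := lindelof rhoP (fun p Up => (hr p Up).1) A0.
pose B n := mball rho (c n) (r (c n)).
exists (\bigcup_n B n); split => //; first by apply: bigcupT_measurable => n; exact: mB.
pose F n := \big[setU/set0]_(i < n.+1) B i.
have mF n : measurable (F n) by apply: bigsetU_measurable => *; exact: mB.
have ndF : nondecreasing_seq F.
  by move=> m n mn; apply/subsetPset; exact: subset_bigsetU.
have FB : \bigcup_n F n = \bigcup_n B n by exact: bigcup_bigsetU_bigcup.
have cvF : lam (F n) @[n --> \oo] --> lam (\bigcup_n B n).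
  rewrite -FB; apply: nondecreasing_cvg_mu => //.
  by rewrite FB; by apply: bigcupT_measurable => *; exact: mB.
rewrite -(cvg_lim _ cvF) //; apply: lime_le; first by apply/cvg_ex; eexists; exact: cvF.
apply: nearW => n /=.
have [t [ut _ tt tc]] := vitali_finite rhoP c (r \o c) (iota 0 n.+1).
have mt (i : nat) : i \in t -> measurable (mball rho (c i) (3 * r (c i))) by [].
apply: (@le_trans _ _ (lam (\big[setU/set0]_(i <- t) mball rho (c i) (3 * r (c i))))).
  apply: le_measure; rewrite ?inE //; first by apply: bigsetU_measurable => *; exact: mB.
  rewrite /F -bigcup_mkord -bigcup_seq => x [i /= ilt Bx].
  have [|j jt h] := tc i; first by rewrite mem_iota.
  by exists j => //; exact: h.
apply: (@le_trans _ _ (\sum_(i <- t) lam (mball rho (c i) (3 * r (c i))))).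
  elim: (t) => [|i s IH]; first by rewrite !big_nil measure0.
  rewrite !big_cons; apply: le_trans (leeD (lexx _) IH); apply: measureU2 => //.
  apply: bigsetU_measurable => *; exact: mB.
apply: (@le_trans _ _ (\sum_(i <- t) K%:E * sig (B i))).
  by apply: lee_sum => i _; exact: (hr _ (cA i)).2.
rewrite -ge0_sume_distrr; last by move=> *; exact: measure_ge0.
apply: lee_wpmul2l; first by rewrite lee_fin.
rewrite (fsbig_seq _ (fun i => sig (B i))) // -measure_fin_bigcup //; last by move=> *; exact: mB.
apply: le_measure; rewrite ?inE //.
by apply: bigcup_measurable => *; exact: mB.
Qed.

End weak_type.

Definition upper_regular {R : realType} {Z : Type} (rho : Z -> Z -> R)
    (lam : set Z -> \bar R) (D : nat) (p : Z) : Prop :=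
  exists2 r0 : R, 0 < r0 &
    forall r : R, 0 < r < r0 -> (lam (mball rho p r) <= (2 * r ^+ D)%:E)%E.

Section maximal.
Context {R : realType} d {Z : measurableType d}.
Variable rho : Z -> Z -> R.
Hypothesis rhoP : separable_metric rho.
Hypothesis mB : forall p r, measurable (mball rho p r).
Variables (lam : {measure set Z -> \bar R}) (D : nat).
Local Open Scope ereal_scope.

Lemma maximal_estimate (sig : {measure set Z -> \bar R}) (c r0 : R) :
  (0 < c)%R ->
  exists S, [/\ measurable S,
    [set p | (forall r : R, (0 < r < r0)%R ->
                lam (mball rho p r) <= (2 * r ^+ D)%:E) /\
      exists r : R, [/\ (0 < r)%R, (3 * r < r0)%R &
        (c * r ^+ D)%:E < sig (mball rho p r)]] `<=` S &
    lam S <= (2 * 3 ^+ D / c)%:E * sig setT].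
Proof.
move=> c0; apply: (weak_type rhoP mB) => [|p [ur [r [r_gt0 r3 sr]]]].
  by rewrite divr_ge0 ?mulr_ge0 ?exprn_ge0 ?ltW.
exists r => //; apply: (le_trans (ur _ _)).
  by rewrite r3 mulr_gt0.
have -> : (2 * (3 * r) ^+ D)%:E = (2 * 3 ^+ D / c)%:E * (c * r ^+ D)%:E.
  by rewrite -EFinM exprMn; congr EFin; field; rewrite gt_eqF.
by apply: lee_wpmul2l; [rewrite lee_fin divr_ge0 ?mulr_ge0 ?exprn_ge0 ?ltW|exact: ltW].
Qed.

Lemma maximal_borel_cantelli (sig : nat -> {measure set Z -> \bar R})
    (c : nat -> R) : (forall n, 0 < c n)%R ->
  \sum_(n <oo) ((c n)^-1)%:E * sig n setT < +oo ->
  {ae lam, forall p, upper_regular rho lam D p -> exists2 r1 : R, (0 < r1)%R &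
    \forall n \near \oo, forall r : R, (0 < r < r1)%R ->
      sig n (mball rho p r) <= (c n * r ^+ D)%:E}.
Proof.
move=> c0 csum.
have /choice [S hS] : forall kn : nat * nat, exists S, _ :=
  fun kn => maximal_estimate (sig kn.2) (kn.1.+1%:R^-1) (c0 kn.2).
have mS k n : measurable (S (k, n)) by have [] := hS (k, n).
have S0 k : lam (lim_sup_set (fun n => S (k, n))) = 0.
  apply: lim_sup_set_cvg0 => //.
  have -> : +oo = (2 * 3 ^+ D : R)%:E * +oo.
    by rewrite mulry gtr0_sg ?mul1e // mulr_gt0 ?exprn_gt0.
  apply: (@le_lt_trans _ _ ((2 * 3 ^+ D : R)%:E *
     \sum_(n <oo) ((c n)^-1)%:E * sig n setT)); last first.
    by rewrite lte_pmul2l // lte_fin mulr_gt0 ?exprn_gt0.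
  rewrite -nneseriesZl; last first.
    by move=> n _; rewrite mule_ge0 // lee_fin invr_ge0 ltW.
  apply: lee_nneseries => // n _.
  by rewrite muleA -EFinM; have [] := hS (k, n).
exists (\bigcup_k lim_sup_set (fun n => S (k, n))); split.
- apply: bigcupT_measurable => k; apply: bigcapT_measurable => n.
  by apply: bigcup_measurable.
- apply/measure_negligible.
    apply: bigcupT_measurable => k; apply: bigcapT_measurable => n.
    by apply: bigcup_measurable.
  apply: negligible_bigcup => k; apply/negligibleP; last exact: S0.
  by apply: bigcapT_measurable => n; apply: bigcup_measurable.
move=> p; apply: contra_notP => nlim [r0 r00 ur].
have [k /= hk] : exists k : nat, (k.+1%:R^-1 < r0)%R.
  by have [k hk] := ltr_add_invr (y := 0%R : R) r00; exists k; rewrite add0r in hk.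
set w : R := k.+1%:R^-1%R in hk.
have w0 : (0 < w)%R by rewrite invr_gt0.
exists (w / 3)%R; first by rewrite divr_gt0.
apply: contrapT => nn; apply: nlim; exists k => // n _.
apply: contrapT => nSn; apply: nn; exists n => // m /= nm r /andP[r_gt0 rw].
rewrite leNgt; apply/negP => h; apply: nSn; exists m => //.
have [_ + _] := hS (k, m); apply; split => [s /andP[s0 sk]|].
  by apply: ur; rewrite s0 (lt_trans sk).
by exists r; split => //; rewrite mulrC -ltr_pdivlMr.
Qed.

End maximal.

(** * Differentiation of measures *)

Section density.
Context {R : realType} d {Z : measurableType d}.
Variable rho : Z -> Z -> R.
Hypothesis rhoP : separable_metric rho.
Hypothesis mB : forall p r, measurable (mball rho p r).
Hypothesis generated : @measurable d Z `<=` <<s mopen rho >>.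
Variables (lam : {measure set Z -> \bar R}) (D : nat).
Hypothesis reg : {ae lam, forall p, upper_regular rho lam D p}.
Local Open Scope ereal_scope.

Definition vanish (sig : set Z -> \bar R) (A : set Z) (p : Z) : Prop :=
  forall e : R, (0 < e)%R -> exists2 r0 : R, (0 < r0)%R &
    forall r : R, (0 < r < r0)%R -> sig (mball rho p r `&` A) <= (e * r ^+ D)%:E.

Definition thin (sig : set Z -> \bar R) (A : set Z) : Prop :=
  {ae lam, forall p, ~ A p -> vanish sig A p}.

Section fixed_measure.
Variable sig : {finite_measure set Z -> \bar R}.

Lemma vanish_disjoint (A : set Z) (p : Z) (r : R) : (0 < r)%R ->
  mball rho p r `<=` ~` A -> vanish sig A p.
Proof.
move=> r0 BA e e0; exists r => // s /andP[s0 sr].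
rewrite (_ : _ `&` _ = set0) ?measure0 ?lee_fin ?mulr_ge0 ?exprn_ge0 ?ltW //.
apply/seteqP; split => // x [xs Ax]; apply: (BA x) => //.
exact: lt_trans xs sr.
Qed.

Lemma vanish_sub (A B : set Z) (p : Z) : measurable A -> measurable B ->
  A `<=` B -> vanish sig B p -> vanish sig A p.
Proof.
move=> mA mB' AB vB e e0; have [r r0 hr] := vB e e0; exists r => // s hs.
apply: le_trans (hr s hs); apply: le_measure; rewrite ?inE.
- exact: measurableI.
- exact: measurableI.
- exact: setIS.
Qed.

Lemma vanishU (A B : set Z) (p : Z) : measurable A -> measurable B ->
  vanish sig A p -> vanish sig B p -> vanish sig (A `|` B) p.
Proof.
move=> mA mB' vA vB e e0.
have e2 : (0 < e / 2)%R by rewrite divr_gt0.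
have [r r0 hr] := vA _ e2; have [s s0 hs] := vB _ e2.
exists (Num.min r s); first by rewrite lt_min r0.
move=> x /andP[x0]; rewrite lt_min => /andP[xr xs].
rewrite setIUr; apply: le_trans (measureU2 _ _ _) _.
- exact: measurableI.
- exact: measurableI.
- apply: (le_trans (leeD (hr x _) (hs x _))); rewrite ?x0 //.
  by rewrite -EFinD -mulrDl -splitr.
Qed.

Lemma thin_bigcup (A : nat -> set Z) : (forall n, measurable (A n)) ->
  (forall n, thin sig (A n)) -> thin sig (\bigcup_n A n).
Proof.
move=> mA tA.
pose C n := \big[setU/set0]_(i < n) A i.
have mC n : measurable (C n) by apply: bigsetU_measurable => *; exact: mA.
have mU : measurable (\bigcup_n A n) by apply: bigcupT_measurable.
pose T n := (\bigcup_n A n) `\` C n.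
have mT n : measurable (T n) by exact: measurableD.
have T0 : sig (T n) @[n --> \oo] --> 0.
  rewrite -(measure0 sig) (_ : set0 = \bigcap_n T n).
    apply: nonincreasing_cvg_mu => //.
    - by rewrite ltey_eq fin_num_measure.
    - exact: bigcapT_measurable.
    - by move=> m n mn; apply/subsetPset; apply: setDS; exact: subset_bigsetU.
  apply/seteqP; split => // x xT; have [[i _ Aix] _] := xT 0%N I.
  by have [_] := xT i.+1 I; apply; rewrite /C big_ord_recr; right.
have /choice [f hf] : forall k : nat, exists n,
    sig (T n) <= (k.+1%:R^-1 * (1 / (2 ^ k.+1)%:R))%:E.
  move=> k.
  have e0 : (0 < k.+1%:R^-1 * (1 / (2 ^ k.+1)%:R) :> R)%R.
    by rewrite mulr_gt0 ?divr_gt0 ?invr_gt0 // ltr0n expn_gt0.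
  have /fine_cvgP[_ /cvgr0_norm_lt /(_ _ e0) [n _ hn]] := T0.
  exists n; rewrite -(fineK (fin_num_measure sig _ (mT n))) lee_fin.
  by apply: le_trans (ler_norm _) (ltW (hn n (leqnn n))).
have c0 k : (0 < k.+1%:R^-1 :> R)%R by rewrite invr_gt0.
have BC := @maximal_borel_cantelli R d Z rho rhoP mB lam D
  (fun k => mrestr sig (mT (f k))) (fun k => k.+1%:R^-1%R) c0.
have {BC} : {ae lam, forall p, upper_regular rho lam D p ->
    exists2 r1 : R, (0 < r1)%R & \forall n \near \oo, forall r : R, (0 < r < r1)%R ->
      mrestr sig (mT (f n)) (mball rho p r) <= (n.+1%:R^-1 * r ^+ D)%:E}.
  apply: BC; apply: le_lt_trans (ltry 1).
  apply: le_trans (epsilon_trick0 xpredT (@ler01 R)).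
  apply: lee_nneseries => [n _ _|n _].
    by rewrite mule_ge0 ?lee_fin ?invr_ge0.
  rewrite -[X in (_ * X <= _)]/(sig (setT `&` T (f n))) setTI.
  apply: (le_trans (lee_wpmul2l _ (hf n))).
    by rewrite lee_fin invr_ge0 ltW.
  by rewrite -EFinM lee_fin mulKf ?gt_eqF.
have {tA} : {ae lam, forall p, forall n, ~ A n p -> vanish sig (A n) p}.
  exact/ae_foralln.
apply: filterS3 reg => p /= ur vA /(_ ur) [r1 r10 bc] nAp e e0.
have vC n : vanish sig (C n) p.
  elim: n => [|n IH].
    rewrite /C big_ord0; apply: (vanish_disjoint (r := 1)) => //.
    by rewrite setC0.
  rewrite /C big_ord_recr /=; apply: vanishU => //; [exact: mC|apply: vA => Anp].
  by apply: nAp; exists n.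
have e2 : (0 < e / 2)%R by rewrite divr_gt0.
have [n [/= hn1 hn2]] := filter_ex (filterI bc
  (near_infty_natSinv_lt (PosNum e2))).
have [r r0 hr] := vC (f n) _ e2.
exists (Num.min r r1); first by rewrite lt_min r0.
move=> x /andP[x0]; rewrite lt_min => /andP[xr xr1].
have -> : \bigcup_n A n = C (f n) `|` T (f n).
  rewrite /T setUDr setDv setD0; apply/esym/setUidPr => y.
  by rewrite /C -bigcup_mkord => -[i _ Ay]; exists i.
rewrite setIUr; apply: le_trans (measureU2 _ _ _) _.
- exact: measurableI.
- exact: measurableI.
- apply: (le_trans (leeD (hr x _) (hn1 x _))); rewrite ?x0 //.
  rewrite -EFinD lee_fin -mulrDl; apply: ler_wpM2r; first by rewrite exprn_ge0 ?ltW.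
  by rewrite [leRHS]splitr lerD2l ltW.
Qed.

(* The sets A such that both A and its complement are thin form a sigma-algebra
   containing the open sets, so no regularity of sig is needed. *)
Lemma thin_measurable (A : set Z) : measurable A -> thin sig A.
Proof.
move=> /generated mA; have [rxx rsym rtri _] := rhoP.
pose G := [set A : set Z | [/\ measurable A, thin sig A & thin sig (~` A)]].
suff : G A by case.
have thin0 : thin sig set0.
  apply: aeW => p _; apply: (vanish_disjoint (r := 1)) => //.
  by rewrite setC0.
have thin_open U : mopen rho U -> thin sig (~` U).
  move=> oU; apply: aeW => p; rewrite /setC /= notK => /oU [r r0 BU].
  by apply: (vanish_disjoint r0); rewrite setCK.
apply: mA; split; first split.
- split => //; rewrite setC0; apply: aeW => p nT; exfalso; exact: nT.
- move=> B [mB' tB tBC]; rewrite setTD; split => //; last by rewrite setCK.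
  exact: measurableC.
- move=> B GB; have mBn n : measurable (B n) by case: (GB n).
  split; first exact: bigcupT_measurable.
    by apply: thin_bigcup => // n; case: (GB n).
  have : {ae lam, forall p, forall n, ~ (~` B n) p -> vanish sig (~` B n) p}.
    by apply/ae_foralln => n; case: (GB n).
  apply: filterS => p /= h; rewrite /setC /= notK => -[n _ Bnp].
  apply: (vanish_sub (B := ~` B n)); last by apply: h; rewrite /setC /= notK.
  + by apply: measurableC; exact: bigcupT_measurable.
  + exact: measurableC.
  + by apply: subsetC => x; exists n.
- move=> U oU; split; [exact: (measurable_mopen rhoP mB)| |exact: thin_open].
  pose F n := [set p | mball rho p n.+1%:R^-1 `<=` U].
  have oF n : mopen rho (~` F n).
    move=> p /existsNP[q /not_implyP [pq nUq]].
    exists (n.+1%:R^-1 - rho p q)%R; first by rewrite subr_gt0.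
    move=> x px; apply/existsNP; exists q; apply/not_implyP; split => //.
    rewrite /mball /= in px *.
    apply: le_lt_trans (rtri _ p _) _; rewrite (rsym x).
    by rewrite -ltrBrDr.
  have -> : U = \bigcup_n F n.
    apply/seteqP; split => [p /oU [r r0 BU]|p [n _]]; last first.
      by apply; rewrite /mball /= rxx invr_gt0.
    have [k /= hk] := ltr_add_invr (y := 0%R : R) r0; rewrite add0r in hk.
    by exists k => // x xp; apply: BU; exact: lt_trans xp hk.
  apply: thin_bigcup => n.
    rewrite -[F n]setCK; apply: measurableC.
    exact: (measurable_mopen rhoP mB).
  by rewrite -[F n]setCK; exact: thin_open.
Qed.

End fixed_measure.
End density.

Lemma sandwich_le {R : realType} (q a m l b e : R) : a <= q * m -> `|1 - (m + l)| <= e ->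
  0 <= l <= e -> b <= e -> a + b <= q + e * (1 + 2 * `|q|).
Proof.
move=> aqm ml /andP[l0 le] be.
have h1 : q * (m + l - 1) <= `|q| * e.
  by apply: le_trans (ler_norm _) _; rewrite normrM distrC ler_wpM2l.
have h2 : q * (- l) <= `|q| * e.
  by apply: le_trans (ler_norm _) _; rewrite normrM normrN ler_wpM2l // ger0_norm.
nra.
Qed.

Lemma sandwich_ge {R : realType} (q a m l b e : R) : q * m <= a -> `|1 - (m + l)| <= e ->
  0 <= l <= e -> 0 <= b -> 0 <= e -> q - e * (1 + 2 * `|q|) <= a + b.
Proof.
move=> aqm ml le b0 e0.
have := @sandwich_le R (- q) (- a) m l 0 e _ ml le e0.
by rewrite normrN mulNr lerN2 => /(_ aqm); lra.
Qed.

Section differentiation.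
Context {R : realType} d {Z : measurableType d}.
Variable rho : Z -> Z -> R.
Hypothesis rhoP : separable_metric rho.
Hypothesis mB : forall p r, measurable (mball rho p r).
Hypothesis generated : @measurable d Z `<=` <<s mopen rho >>.
Variables (lam : {finite_measure set Z -> \bar R}) (D : nat).
Hypothesis volume : {ae lam, forall p,
  fine (lam (mball rho p r)) / r ^+ D @[r --> 0^'+] --> (1 : R)}.

Lemma ae_upper_regular : {ae lam, forall p, upper_regular rho lam D p}.
Proof.
apply: filterS volume => p /= /cvgr_dist_lt /(_ 1 ltr01) [r0 /= r00 hr].
exists r0 => // r /andP[r_gt0 rr0].
rewrite -(fineK (fin_num_measure lam _ (mB p r))) lee_fin -ler_pdivrMr ?exprn_gt0 //.
have := hr r; rewrite /ball_ /= sub0r normrN gtr0_norm // => /(_ rr0 r_gt0).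
by rewrite ltr_norml => /andP[]; lra.
Qed.

Lemma has_density_le (nu : set Z -> \bar R) (H : Z -> R) (q : R) (A : set Z) :
  has_density nu lam H -> measurable A -> (forall x, A x -> H x <= q) ->
  (nu A <= q%:E * lam A)%E.
Proof.
move=> [iH nuE] mA hA; rewrite nuE //.
rewrite -integral_cst //; apply: le_integral => //.
- exact: (integrableS measurableT).
- exact: finite_measure_integrable_cst.
- by move=> x /set_mem Ax; rewrite lee_fin hA.
Qed.

Lemma has_density_ge (nu : set Z -> \bar R) (H : Z -> R) (q : R) (A : set Z) :
  has_density nu lam H -> measurable A -> (forall x, A x -> q <= H x) ->
  (q%:E * lam A <= nu A)%E.
Proof.
move=> [iH nuE] mA hA; rewrite nuE //.
rewrite -integral_cst //; apply: le_integral => //.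
- exact: finite_measure_integrable_cst.
- exact: (integrableS measurableT).
- by move=> x /set_mem Ax; rewrite lee_fin hA.
Qed.

Variables (nu : {finite_measure set Z -> \bar R}) (H : Z -> R).
Hypothesis dH : has_density nu lam H.

Lemma vanish_fine (sig : {finite_measure set Z -> \bar R}) (A : set Z) (p : Z) :
  measurable A -> vanish rho D sig A p -> forall e : R, 0 < e ->
  \forall r \near 0^'+, 0 <= fine (sig (mball rho p r `&` A)) / r ^+ D <= e.
Proof.
move=> mA vA e e0; have [r0 r00 hr] := vA e e0; exists r0 => //= r.
rewrite /ball_ /= sub0r normrN => + r_gt0; rewrite gtr0_norm // => rr0.
have fin := fin_num_measure sig _ (measurableI _ _ (mB p r) mA).
apply/andP; split; first by apply: divr_ge0; [exact: fine_ge0|exact: exprn_ge0 (ltW r_gt0)].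
by rewrite ler_pdivrMr ?exprn_gt0 // -lee_fin (fineK fin) hr // r_gt0.
Qed.

Lemma fine_split (sig : {finite_measure set Z -> \bar R}) (A B : set Z) :
  measurable A -> measurable B ->
  fine (sig B) = fine (sig (B `&` A)) + fine (sig (B `&` ~` A)).
Proof.
move=> mA mB'; have mC := measurableC mA.
rewrite -fineD ?fin_num_measure //; try exact: measurableI.
rewrite -measureU; [by rewrite -setIUr setUv setIT|exact: measurableI|exact: measurableI|].
by rewrite setIACA setICr setI0.
Qed.

Theorem density_differentiation : {ae lam, forall p,
  fine (nu (mball rho p r)) / r ^+ D @[r --> 0^'+] --> H p}.
Proof.
have mH : measurable_fun setT H.
  by apply/measurable_EFinP; exact: (measurable_int _ dH.1).
pose L (q : rat) := [set x | H x < ratr q].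
pose G (q : rat) := [set x | ratr q < H x].
have mL q : measurable (L q).
  by rewrite -[L q]setTI /L -preimage_itvNyo; exact: mH.
have mG q : measurable (G q).
  by rewrite -[G q]setTI /G -preimage_itvoy; exact: mH.
have tA (sig : {finite_measure set Z -> \bar R}) (A : rat -> set Z) :
    (forall q, measurable (A q)) ->
    {ae lam, forall p, forall q, A q p -> vanish rho D sig (~` A q) p}.
  move=> mA; have : {ae lam, forall p, forall n : nat,
      if unpickle n is Some q then A q p -> vanish rho D sig (~` A q) p else True}.
    apply/ae_foralln => n; case: unpickle => [q|]; last by apply: aeW.
    have := thin_measurable rhoP mB generated ae_upper_regular sig (measurableC (mA q)).
    rewrite /thin => h; apply: filterS h => p /= h Ap.
    by apply: h; rewrite /setC /= notK.
  by apply: filterS => p h q; have := h (pickle q); rewrite pickleK.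
have tt := filterI volume
  (filterI (filterI (tA lam _ mL) (tA lam _ mG)) (filterI (tA nu _ mL) (tA nu _ mG))).
apply: filterS (tt _ _ _ _) => p /= [vol [[lL lG] [nL nG]]].
apply/cvgrPdist_le => e e0.
have bound (q : R) : 0 < e / 2 / (1 + 2 * `|q|).
  by rewrite divr_gt0 ?divr_gt0 // ltr_wpDr ?mulr_ge0.
have /rat_in_itvoo [q] : H p < H p + e / 2 by rewrite ltrDl divr_gt0.
rewrite in_itv /= => /andP[Hq qH].
have /rat_in_itvoo [s] : H p - e / 2 < H p by rewrite ltrBlDr ltrDl divr_gt0.
rewrite in_itv /= => /andP[Hs sH].
have eq0 := bound (ratr q); have es0 := bound (ratr s).
set eq := _ / _ in eq0; set es := _ / _ in es0.
have keyq : eq * (1 + 2 * `|ratr q|) = e / 2.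
  by rewrite /eq divfK // gt_eqF // ltr_wpDr ?mulr_ge0.
have keys : es * (1 + 2 * `|ratr s|) = e / 2.
  by rewrite /es divfK // gt_eqF // ltr_wpDr ?mulr_ge0.
have volP (x : R) : 0 < x -> \forall r \near 0^'+, `|1 - fine (lam (mball rho p r)) / r ^+ D| <= x.
  by move=> x0; move: vol => /cvgr_dist_le; exact.
have volq := volP _ eq0; have vols := volP _ es0.
near=> r.
have r0 : 0 < r by near: r; exact: nbhs_right_gt.
have rD : 0 < r ^+ D by rewrite exprn_gt0.
have vq : `|1 - fine (lam (mball rho p r)) / r ^+ D| <= eq by near: r.
have vs : `|1 - fine (lam (mball rho p r)) / r ^+ D| <= es by near: r.
have llq : 0 <= fine (lam (mball rho p r `&` ~` L q)) / r ^+ D <= eq.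
  by near: r; apply: vanish_fine => //; [exact: measurableC|exact: lL].
have lnq : 0 <= fine (nu (mball rho p r `&` ~` L q)) / r ^+ D <= eq.
  by near: r; apply: vanish_fine => //; [exact: measurableC|exact: nL].
have lls : 0 <= fine (lam (mball rho p r `&` ~` G s)) / r ^+ D <= es.
  by near: r; apply: vanish_fine => //; [exact: measurableC|exact: lG].
have lns : 0 <= fine (nu (mball rho p r `&` ~` G s)) / r ^+ D <= es.
  by near: r; apply: vanish_fine => //; [exact: measurableC|exact: nG].
have fin (sig : {finite_measure set Z -> \bar R}) A : measurable A ->
    sig (mball rho p r `&` A) \is a fin_num.
  by move=> mA; rewrite fin_num_measure //; exact: (measurableI _ _ (mB p r) mA).
have upq : fine (nu (mball rho p r `&` L q)) / r ^+ D <=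
    ratr q * (fine (lam (mball rho p r `&` L q)) / r ^+ D).
  rewrite mulrA ler_pM2r ?invr_gt0 // -lee_fin EFinM !fineK ?fin //.
  apply: (has_density_le dH (measurableI _ _ (mB p r) (mL q))) => x [_].
  exact: ltW.
have los : ratr s * (fine (lam (mball rho p r `&` G s)) / r ^+ D) <=
    fine (nu (mball rho p r `&` G s)) / r ^+ D.
  rewrite mulrA ler_pM2r ?invr_gt0 // -lee_fin EFinM !fineK ?fin //.
  apply: (has_density_ge dH (measurableI _ _ (mB p r) (mG s))) => x [_].
  exact: ltW.
have Nq := fine_split nu (mL q) (mB p r).
have Lq := fine_split lam (mL q) (mB p r).
have Ns := fine_split nu (mG s) (mB p r).
have Ls := fine_split lam (mG s) (mB p r).
have Hup : fine (nu (mball rho p r)) / r ^+ D <= ratr q + e / 2.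
  rewrite Nq mulrDl -keyq; rewrite Lq mulrDl in vq.
  exact: (sandwich_le upq vq llq (andP lnq).2).
have Hlo : ratr s - e / 2 <= fine (nu (mball rho p r)) / r ^+ D.
  rewrite Ns mulrDl -keys; rewrite Ls mulrDl in vs.
  exact: (sandwich_ge los vs lls (andP lns).1 (ltW es0)).
by rewrite ler_distlC; apply/andP; split; lra.
Unshelve. all: by end_near. Qed.

End differentiation.

(** * The product metric *)

Lemma measurable_fun_lt {R : realType} d (Z : measurableType d) (f : Z -> R) :
  (forall c, measurable [set x | f x < c]) -> measurable_fun setT f.
Proof.
move=> mf; apply: (measurability _ (RGenInftyO.measurableE R)).
move=> _ [_ [c ->] <-]; rewrite setTI preimage_itvNyo; exact: mf.
Qed.

Section borel_metric.
Context {R : realType} {d : measure_display} {X : borelMetricType R d}.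

Lemma open_measurable_borel (U : set X) : open U -> measurable U.
Proof. by move=> oU; rewrite measurable_borel; apply: sub_sigma_algebra. Qed.

Lemma open_mdist_lt (x : X) (c : R) : open [set y | mdist x y < c].
Proof.
rewrite openE => y /= xy; rewrite /interior.
apply/nbhs_ballP; exists (c - mdist x y); first by rewrite /= subr_gt0.
rewrite ballEmdist => z /= yz.
by apply: le_lt_trans (metric_triangle x y z) _; lra.
Qed.

Lemma measurable_mdist (x : X) : measurable_fun setT (mdist x).
Proof.
apply: measurable_fun_lt => c; apply: open_measurable_borel; exact: open_mdist_lt.
Qed.

Hypothesis cX : compact [set: X].

Lemma compact_metric_dense : exists e : nat -> X,
  forall (x : X) (r : R), 0 < r -> exists n, mdist x (e n) < r.
Proof.
have fin (n : nat) : exists s : seq X,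
    forall x, exists2 y, y \in s & mdist y x < n.+1%:R^-1.
  have n0 : 0 < n.+1%:R^-1 :> R by rewrite invr_gt0.
  move: cX; rewrite compact_cover => /(_ X setT (fun y => [set x | mdist y x < n.+1%:R^-1])).
  case => [y _|x _|D _ cD]; first exact: open_mdist_lt.
    by exists x => //=; rewrite mdistxx.
  by exists (finmap.enum_fset D) => x; have [y /= yD yx] := cD x I; exists y.
have [s hs] := choice fin.
exists (fun n => if unpickle n is Some ij then nth point (s ij.1) ij.2 else point).
move=> x r r0; have [n /= hn] := ltr_add_invr (y := 0 : R) r0.
have [y ys yx] := hs n x; exists (pickle (n, index y (s n))).
rewrite pickleK /= nth_index // metric_sym; apply: lt_trans yx _.
by rewrite add0r in hn.
Qed.

Lemma measurable_mdist_lt d' (Z : measurableType d') (f g : Z -> X) (c : R) :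
  measurable_fun setT f -> measurable_fun setT g ->
  measurable [set z | mdist (f z) (g z) < c].
Proof.
move=> mf mg; have [e de] := compact_metric_dense.
have -> : [set z | mdist (f z) (g z) < c] =
    \bigcup_n [set z | mdist (e n) (f z) + mdist (e n) (g z) < c].
  apply/seteqP; split => z /=; last first.
    move=> [n _ /=]; apply: le_lt_trans.
    by rewrite (metric_sym (e n) (f z)); exact: metric_triangle.
  move=> fg; have [n hn] := de (g z) ((c - mdist (f z) (g z)) / 2) ltac:(lra).
  exists n => //=; move: hn (metric_triangle (e n) (g z) (f z)).
  by rewrite (metric_sym (e n) (g z)) (metric_sym (g z) (f z)); lra.
apply: bigcupT_measurable => n.
rewrite -[X in measurable X]setTI -preimage_itvNyo.
by apply: measurable_funD => //; apply: measurableT_comp => //; exact: measurable_mdist.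
Qed.

End borel_metric.

Section product_metric.
Context {R : realType} {d1 d2 : measure_display}.
Context {X : borelMetricType R d1} {Y : borelMetricType R d2}.

Lemma pdist_ge_fst (p q : X * Y) : mdist p.1 q.1 <= pdist p q.
Proof.
rewrite /pdist -[leLHS]ger0_norm ?mdist_ge0 // -sqrtr_sqr ler_sqrt ?lerDl ?sqr_ge0 //.
by rewrite addr_ge0 ?sqr_ge0.
Qed.

Lemma pdist_ge_snd (p q : X * Y) : mdist p.2 q.2 <= pdist p q.
Proof.
rewrite /pdist -[leLHS]ger0_norm ?mdist_ge0 // -sqrtr_sqr ler_sqrt ?lerDr ?sqr_ge0 //.
by rewrite addr_ge0 ?sqr_ge0.
Qed.

Lemma pdist_triangle (p q s : X * Y) : pdist p s <= pdist p q + pdist q s.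
Proof.
rewrite /pdist.
have := metric_triangle p.1 q.1 s.1; have := metric_triangle p.2 q.2 s.2.
have := mdist_ge0 p.1 q.1; have := mdist_ge0 p.2 q.2.
have := mdist_ge0 q.1 s.1; have := mdist_ge0 q.2 s.2.
have := mdist_ge0 p.1 s.1; have := mdist_ge0 p.2 s.2.
set a := mdist p.1 q.1; set b := mdist q.1 s.1; set c := mdist p.2 q.2.
set e := mdist q.2 s.2; set f := mdist p.1 s.1; set g := mdist p.2 s.2.
move=> g0 f0 e0 b0 c0 a0 gce fab.
have S0 (x y : R) : 0 <= x ^+ 2 + y ^+ 2 by rewrite addr_ge0 ?sqr_ge0.
set u := Num.sqrt (a ^+ 2 + c ^+ 2); set w := Num.sqrt (b ^+ 2 + e ^+ 2).
have u0 : 0 <= u by exact: sqrtr_ge0.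
have w0 : 0 <= w by exact: sqrtr_ge0.
have uE : u ^+ 2 = a ^+ 2 + c ^+ 2 by rewrite sqr_sqrtr.
have wE : w ^+ 2 = b ^+ 2 + e ^+ 2 by rewrite sqr_sqrtr.
rewrite -[leRHS]ger0_norm ?addr_ge0 // -sqrtr_sqr ler_sqrt ?sqr_ge0 //.
have abce : a * b + c * e <= u * w.
  rewrite -ler_sqr ?nnegrE ?addr_ge0 ?mulr_ge0 // exprMn uE wE.
  by have := sqr_ge0 (a * e - c * b); nra.
have : f ^+ 2 <= (a + b) ^+ 2 by rewrite ler_sqr ?nnegrE ?addr_ge0.
have : g ^+ 2 <= (c + e) ^+ 2 by rewrite ler_sqr ?nnegrE ?addr_ge0.
nra.
Qed.

Hypotheses (cX : compact [set: X]) (cY : compact [set: Y]).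

Lemma pdist_separable : separable_metric (@pdist R d1 d2 X Y).
Proof.
split.
- by move=> p; rewrite /pdist !mdistxx expr0n /= addr0 sqrtr0.
- by move=> p q; rewrite /pdist metric_sym [mdist p.2 _]metric_sym.
- exact: pdist_triangle.
have [e de] := compact_metric_dense cX; have [f df] := compact_metric_dense cY.
exists (fun n => if unpickle n is Some ij then (e ij.1, f ij.2) else point).
move=> p r r0; have r2 : 0 < r / 2 by rewrite divr_gt0.
have [i hi] := de p.1 _ r2; have [j hj] := df p.2 _ r2.
exists (pickle (i, j)); rewrite pickleK /pdist /=.
rewrite -[ltRHS]ger0_norm ?ltW // -sqrtr_sqr ltr_sqrt ?exprn_gt0 //.
by have := mdist_ge0 p.1 (e i); have := mdist_ge0 p.2 (f j); nra.
Qed.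

Lemma measurable_pdist (p : X * Y) : measurable_fun setT (pdist p).
Proof.
apply: (measurableT_comp (f := @Num.sqrt R)).
  by apply: continuous_measurable_fun; exact: sqrt_continuous.
apply: measurable_funD; apply: measurable_funX.
  by apply: measurableT_comp => //; exact: measurable_mdist.
by apply: measurableT_comp => //; exact: measurable_mdist.
Qed.

Lemma measurable_pball (p : X * Y) (r : R) : measurable (mball pdist p r).
Proof.
rewrite -[mball _ _ _]setTI /mball -preimage_itvNyo; exact: measurable_pdist.
Qed.

Lemma prod_measurable_generated :
  @measurable _ (X * Y)%type `<=` <<s mopen (@pdist R d1 d2 X Y) >>.
Proof.
have [s0 sC sU] : sigma_algebra setT <<s mopen (@pdist R d1 d2 X Y) >>.
  exact: smallest_sigma_algebra.
apply: smallest_sub => [//|A [[B mB <-]|[B mB <-]]]; rewrite setTI.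
- move: mB; rewrite /= measurable_borel.
  apply: (smallest_sub (X := [set B | <<s mopen (@pdist R d1 d2 X Y) >> (fst @^-1` B)])).
  split => [|C|C hC] /=.
  + by rewrite preimage_set0.
  + by rewrite !setTD preimage_setC -setTD; exact: sC.
  + by rewrite preimage_bigcup; exact: sU.
  move=> U /= oU; apply: sub_sigma_algebra => p Up.
  have /nbhs_ballP[r /= r0 rU] : nbhs p.1 U by exact: open_nbhs_nbhs.
  exists r => // q pq; apply: rU; rewrite ballEmdist /=.
  exact: le_lt_trans (pdist_ge_fst p q) pq.
- move: mB; rewrite /= measurable_borel.
  apply: (smallest_sub (X := [set B | <<s mopen (@pdist R d1 d2 X Y) >> (snd @^-1` B)])).
  split => [|C|C hC] /=.
  + by rewrite preimage_set0.
  + by rewrite !setTD preimage_setC -setTD; exact: sC.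
  + by rewrite preimage_bigcup; exact: sU.
  move=> U /= oU; apply: sub_sigma_algebra => p Up.
  have /nbhs_ballP[r /= r0 rU] : nbhs p.2 U by exact: open_nbhs_nbhs.
  exists r => // q pq; apply: rU; rewrite ballEmdist /=.
  exact: le_lt_trans (pdist_ge_snd p q) pq.
Qed.

End product_metric.

(** * The marginal of the invariant measure *)

Section ergodic_density.
Context {R : realType} d {X : measurableType d}.
Variables (mu sig : probability X R) (phi : X -> \bar R) (T : X -> X).
Local Open Scope ereal_scope.
Hypothesis iphi : mu.-integrable setT phi.
Hypothesis sigE : forall A, measurable A -> sig A = \int[mu]_(x in A) phi x.
Hypothesis mT : measurable_fun setT T.
Hypothesis inv_mu : invariant_measure mu T.
Hypothesis inv_sig : invariant_measure sig T.
Hypothesis erg : ergodic mu T.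

Let mphi : measurable_fun setT phi := measurable_int _ iphi.

Let mpreT (A : set X) : measurable A -> measurable (T @^-1` A).
Proof. by move=> mA; rewrite -[_ @^-1` _]setTI; exact: mT. Qed.

Lemma density_gt1_null (A : set X) : measurable A ->
  (forall x, A x -> 1 < phi x) -> sig A <= mu A -> mu A = 0.
Proof.
move=> mA phi1 le.
have iA : mu.-integrable A phi by exact: (integrableS measurableT).
have i1 : mu.-integrable A (cst 1) by exact: finite_measure_integrable_cst.
have ge0 x : A x -> 0 <= phi x - 1.
  by move=> Ax; rewrite sube_ge0 // ltW // phi1.
have int0 : \int[mu]_(x in A) `|phi x - 1| = 0.
  apply/eqP; rewrite eq_le integral_ge0 // andbT.
  under eq_integral => x /set_mem Ax do rewrite gee0_abs ?ge0 //.
  rewrite (integralB mA iA i1) -sigE // integral_cst // mul1e.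
  by rewrite leeBlDr ?add0e // fin_num_measure.
have mB : measurable_fun A (fun x => phi x - 1).
  by apply: emeasurable_funB => //; exact: measurable_funTS.
have /(ae_eq_integral_abs mu mA mB) := int0.
move=> [N [mN N0 AN]]; apply/eqP; rewrite -measure_le0 -N0.
apply: le_measure; rewrite ?inE //; apply: subset_trans AN => x Ax /=.
by move=> /(_ Ax) h; have := phi1 _ Ax; rewrite -sube_gt0 // h ltxx.
Qed.

(* E = {phi > 1} is a maximizer of sig - mu, and so is T^-1 E by invariance;
   hence they agree up to a mu-null set, and the limsup of the preimages of E
   is a strictly invariant set equal to E almost everywhere. *)
Lemma ergodic_density_le (A : set X) : measurable A -> sig A <= mu A.
Proof.
move=> mA; pose E := [set x | 1 < phi x].
have mE : measurable E.
  by rewrite -[E]setTI; exact: emeasurable_fun_o_infty.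
have mE' := mpreT mE; set E' := T @^-1` E in mE'.
have mEE' := measurableD mE mE'; have mE'E := measurableD mE' mE.
have balance (m : probability X R) : m E' = m E -> m (E' `\` E) = m (E `\` E').
  move=> mm; have fin B : measurable B -> m B \is a fin_num by exact: fin_num_measure.
  have e1 : m E' = m (E' `\` E) + m (E `&` E').
    by rewrite setIC; exact: (measureDI m mE' mE).
  have e2 : m E = m (E `\` E') + m (E `&` E') by exact: (measureDI m mE mE').
  have finI := fin _ (measurableI _ _ mE mE').
  by rewrite -[LHS](addeK _ finI) -e1 mm e2 addeK.
have bmu := balance mu (inv_mu mE); have bsig := balance sig (inv_sig mE).
have E0 : mu (E `\` E') = 0.
  apply: density_gt1_null => //; first by move=> x [].
  rewrite -bsig -bmu sigE // -[leRHS]mul1e -integral_cst //.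
  apply: le_integral => //.
  - exact: (integrableS measurableT).
  - exact: finite_measure_integrable_cst.
  - by move=> x /set_mem[_ /negP]; rewrite -leNgt.
have E'0 : mu (E' `\` E) = 0 by rewrite bmu.
pose D n := (iter n T @^-1` E).
have itS n (x : X) : iter n.+1 T x = iter n T (T x) by rewrite iterSr.
have mD n : measurable (D n).
  elim: n => [|n IH]; first exact: mE.
  rewrite (_ : D n.+1 = T @^-1` D n); first exact: mpreT.
  by apply/seteqP; split => x; rewrite /D /preimage /= -iterSr.
have preD (B C : set X) n : measurable (B `\` C) -> mu (B `\` C) = 0 ->
    measurable ((iter n T @^-1` B) `\` (iter n T @^-1` C)) /\
    mu ((iter n T @^-1` B) `\` (iter n T @^-1` C)) = 0.
  move=> mBC BC0; elim: n => [//|n [mn n0]].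
  rewrite (_ : _ `\` _ = T @^-1` ((iter n T @^-1` B) `\` (iter n T @^-1` C))).
    by split; [exact: mpreT|rewrite inv_mu].
  by apply/seteqP; split => x; rewrite /preimage /setD /= -iterSr.
have nullN (B C : set X) : measurable (B `\` C) -> mu (B `\` C) = 0 -> mu.-negligible (B `\` C).
  by move=> m0 n0; apply/negligibleP.
have negU n : mu.-negligible (D n `\` E) /\ mu.-negligible (E `\` D n).
  elim: n => [|n [IH1 IH2]]; first by rewrite setDv; split; exact: negligible_set0.
  have [m1 n1] := preD _ _ n mE'E E'0; have [m2 n2] := preD _ _ n mEE' E0.
  split.
    apply: negligibleS (negligibleU (nullN _ _ m1 n1) IH1) => x [DSx nEx].
    by have [Dx|nDx] := pselect (D n x); [right|left].
  apply: negligibleS (negligibleU (nullN _ _ m2 n2) IH2) => x [Ex nDx].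
  by have [Dx|nDx'] := pselect (D n x); [left|right].
pose F := lim_sup_set D.
have mF : measurable F by apply: bigcapT_measurable => n; apply: bigcup_measurable.
have invF : T @^-1` F = F.
  apply/seteqP; split => x Fx n _.
    by have [k nk Dk] := Fx n I; exists k.+1; [exact: leqW|rewrite /D /preimage /= -iterS iterSr].
  have [[|k] nk Dk] := Fx n.+1 I; first by [].
  by exists k => //; move: Dk; rewrite /D /preimage /= -iterS iterSr.
have negF : mu.-negligible (F `\` E).
  apply: negligibleS (negligible_bigcup (fun n => (negU n).1)) => x [Fx nEx].
  by have [k _ Dk] := Fx 0%N I; exists k.
have negE : mu.-negligible (E `\` F).
  apply: negligibleS (negligible_bigcup (fun n => (negU n).2)) => x [Ex].
  move=> /existsNP[n /not_implyP[_ nD]]; exists n => //; split => // Dn.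
  by apply: nD; exists n => //=.
have null_diff (B C : set X) : measurable B -> measurable C ->
    mu.-negligible (B `\` C) -> mu B <= mu C.
  move=> mB mC nBC; rewrite (measureDI mu mB mC).
  rewrite (measure_negligible (measurableD mB mC) nBC) add0e.
  by apply: le_measure; rewrite ?inE //; exact: measurableI.
have EF : mu E = mu F by apply/le_anti; rewrite !null_diff.
have sigE_le : sig E <= 1 by rewrite probability_le1.
have E_null : mu E = 0.
  have [//|F1] : mu E = 0 \/ mu E = 1 by rewrite EF; exact: erg.
  by apply: density_gt1_null => //; rewrite F1.
have -> : sig A = sig (A `\` E) + sig (A `&` E) by exact: (measureDI sig mA mE).
have -> : sig (A `&` E) = 0.
  rewrite sigE; last exact: measurableI.
  apply: null_set_integral; [exact: measurableI| |].
    by apply: measurable_funTS.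
  apply/eqP; rewrite -measure_le0 -E_null.
  by apply: le_measure; rewrite ?inE //; exact: measurableI.
have mAE := measurableD mA mE.
rewrite adde0 (@le_trans _ _ (mu (A `\` E))) //; last first.
  by apply: le_measure; rewrite ?inE.
rewrite sigE // -[leRHS]mul1e -integral_cst //.
apply: le_integral => //.
- exact: (integrableS measurableT).
- exact: finite_measure_integrable_cst.
- by move=> x /set_mem[_ /negP]; rewrite -leNgt.
Qed.

End ergodic_density.

Section skew_marginal.
Context {R : realType} {d1 d2 : measure_display}.
Context {X : measurableType d1} {Y : measurableType d2}.
Local Open Scope ereal_scope.

Lemma skew_marginal_le (muX : probability X R)
    (lamY : {finite_measure set Y -> \bar R})
    (nu : probability (X * Y)%type R) (h : X * Y -> R) (T : X -> X) (u : X * Y -> Y) :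
  measurable_fun setT T -> invariant_measure muX T -> ergodic muX T ->
  invariant_measure nu (skew_ext T u) -> has_density nu (muX \x lamY) h ->
  forall A, measurable A -> nu (fst @^-1` A) <= muX A.
Proof.
move=> mT invX ergX invnu [ih nuE].
have fst_mfun : (@fst X Y) \in @mfun _ _ (X * Y)%type X by rewrite inE; exact: measurable_fst.
pose sig := distribution nu (mfun_Sub fst_mfun).
apply: (@ergodic_density_le R d1 X muX sig (fubini_F lamY (EFin \o h)) T) => //.
- exact: integrable_fubini_F.
- move=> A mA.
  have mfA : measurable (fst @^-1` A : set (X * Y)).
    by rewrite -[_ @^-1` _]setTI; exact: measurable_fst.
  transitivity (nu (fst @^-1` A)); first by [].
  rewrite nuE // integral_mkcond -integral12_prod_meas1.
    rewrite [RHS]integral_mkcond; apply: eq_integral => x _.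
    rewrite /fubini_F patchE; case: ifPn => xA.
      apply: eq_integral => y _; rewrite patchE ifT //.
    rewrite -[RHS](integral0 lamY setT); apply: eq_integral => y _.
    rewrite patchE ifF //; apply/negbTE; apply: contra xA => /set_mem xA.
    exact: mem_set.
  by apply/(integrable_mkcond _ mfA); exact: (integrableS measurableT).
- move=> A mA; rewrite -[RHS]/(nu (fst @^-1` A)) -(invnu (fst @^-1` A)) //.
  rewrite -[_ @^-1` _]setTI; exact: measurable_fst.
Qed.

End skew_marginal.

(** * Avoidance probabilities *)

Section real_bounds.
Context {R : realType}.

Lemma expRN_quadratic (x : R) : 0 <= x <= 1 -> `|1 - x - expR (- x)| <= x ^+ 2.
Proof.
move=> /andP[x0 x1].
have lo : 1 - x <= expR (- x) by have := expR_ge1Dx (- x).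
have hi : expR (- x) <= 1 - x + x ^+ 2.
  rewrite expRN -ler_pV2 ?inE ?unitfE ?invr_gt0 ?expR_gt0 ?invr_eq0 ?expR_eq0 //; last first.
    by apply/andP; split; [rewrite gt_eqF //|]; nra.
  rewrite invrK; apply: le_trans (expR_ge1Dx x).
  have h : 0 < 1 - x + x ^+ 2 by nra.
  by rewrite -[leLHS]mul1r ler_pdivrMr //; nra.
by rewrite ler_norml; apply/andP; split; lra.
Qed.

Lemma exprB_le (x y : R) (q : nat) : 0 <= x <= 1 -> 0 <= y <= 1 ->
  `|x ^+ q - y ^+ q| <= q%:R * `|x - y|.
Proof.
move=> /andP[x0 x1] /andP[y0 y1]; elim: q => [|q IH].
  by rewrite !expr0 subrr normr0 mul0r.
have -> : x ^+ q.+1 - y ^+ q.+1 = x * (x ^+ q - y ^+ q) + (x - y) * y ^+ q.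
  by rewrite !exprS; ring.
apply: le_trans (ler_normD _ _) _; rewrite !normrM -natr1 mulrDl mul1r lerD //.
  rewrite -[leRHS]mul1r; apply: ler_pM => //.
  by rewrite ger0_norm.
rewrite -[leRHS]mulr1; apply: ler_pM => //.
by rewrite ger0_norm ?exprn_ge0 // exprn_ile1.
Qed.

Lemma expRN_lipschitz (x y : R) : 0 <= x -> 0 <= y ->
  `|expR (- x) - expR (- y)| <= `|x - y|.
Proof.
wlog xy : x y / x <= y => [hw x0 y0|x0 y0].
  have [xy|/ltW yx] := leP x y; first exact: hw.
  by rewrite distrC (distrC x); exact: hw.
have h : expR (- y) <= expR (- x) by rewrite ler_expR lerN2.
rewrite ger0_norm ?subr_ge0 // distrC ger0_norm ?subr_ge0 //.
have -> : expR (- y) = expR (- x) * expR (- (y - x)) by rewrite -expRD; congr expR; ring.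
have e1 : expR (- x) <= 1 by rewrite -expR0 ler_expR oppr_le0.
have := expR_gt0 (- x); have := expR_ge1Dx (- (y - x)).
by nra.
Qed.

Lemma recursion_bound (a : nat -> R) (s q : nat) (x err : R) :
  0 <= x <= 1 -> a 0%N = 1 ->
  (forall m, `|a (s + m)%N - (1 - x) * a m| <= err) ->
  `|a (q * s)%N - (1 - x) ^+ q| <= q%:R * err.
Proof.
move=> /andP[x0 x1] a0 rec; elim: q => [|q IH].
  by rewrite mul0n a0 expr0 subrr normr0 mul0r.
have -> : a (q.+1 * s)%N - (1 - x) ^+ q.+1 =
    (a (s + q * s)%N - (1 - x) * a (q * s)%N) +
    (1 - x) * (a (q * s)%N - (1 - x) ^+ q).
  by rewrite mulSn exprS; ring.
have -> : q.+1%:R * err = err + q%:R * err by rewrite -natr1; ring.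
apply: le_trans (ler_normD _ _) _; apply: lerD => //.
rewrite normrM -[leRHS]mul1r; apply: ler_pM => //.
by rewrite ger0_norm; lra.
Qed.

End real_bounds.

Section no_visit.
Context {R : realType} d {Z : measurableType d}.
Variables (nu : probability Z R) (f : Z -> Z).
Hypothesis mf : measurable_fun setT f.
Hypothesis invf : invariant_measure nu f.

Definition prob (A : set Z) : R := fine (nu A).

Let fin A : measurable A -> nu A \is a fin_num.
Proof. by move=> mA; exact: fin_num_measure. Qed.

Lemma prob_ge0 A : 0 <= prob A. Proof. by rewrite fine_ge0. Qed.

Lemma prob_le A B : measurable A -> measurable B -> A `<=` B -> prob A <= prob B.
Proof.
by move=> mA mB AB; rewrite fine_le ?fin //; apply: le_measure; rewrite ?inE.
Qed.

Lemma prob_setT : prob setT = 1.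
Proof. by rewrite /prob probability_setT. Qed.

Lemma prob_le1 A : measurable A -> prob A <= 1.
Proof. by move=> mA; rewrite -prob_setT; exact: prob_le. Qed.

Lemma probDI A B : measurable A -> measurable B ->
  prob A = prob (A `\` B) + prob (A `&` B).
Proof.
move=> mA mB; rewrite /prob -fineD ?fin //; [|exact: measurableD|exact: measurableI].
by congr fine; exact: measureDI.
Qed.

Lemma probU_le A B : measurable A -> measurable B ->
  prob (A `|` B) <= prob A + prob B.
Proof.
move=> mA mB; rewrite /prob -fineD ?fin // fine_le ?fin //.
- exact: measurableU.
- by rewrite fin_numD !fin.
- exact: measureU2.
Qed.

Lemma measurable_iter n : measurable_fun setT (iter n f).
Proof.
elim: n => [|n IH]; first exact: measurable_id.
by apply: (measurableT_comp mf).
Qed.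

Lemma measurable_preiter n A : measurable A -> measurable (iter n f @^-1` A).
Proof. by move=> mA; rewrite -[_ @^-1` _]setTI; exact: measurable_iter. Qed.

Lemma prob_preiter n A : measurable A -> prob (iter n f @^-1` A) = prob A.
Proof.
move=> mA; congr fine; elim: n => [//|n IH].
rewrite -IH -(invf (measurable_preiter n mA)); congr (nu _).
by apply/seteqP; split => x; rewrite /preimage /= -iterSr.
Qed.

Variable U : set Z.
Hypothesis mU : measurable U.

Definition no_visit (m : nat) : set Z := [set q | forall i, (i < m)%N -> ~ U (iter i f q)].

Lemma no_visit0 : no_visit 0 = setT.
Proof. by apply/seteqP; split. Qed.

Lemma no_visitS m : no_visit m.+1 = no_visit m `&` ~` (iter m f @^-1` U).
Proof.
apply/seteqP; split => q /=.
  by move=> h; split => [i im|]; apply: h => //; exact: ltnW.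
move=> [h hm] i; rewrite ltnS leq_eqVlt => /predU1P[->//|]; exact: h.
Qed.

Lemma measurable_no_visit m : measurable (no_visit m).
Proof.
elim: m => [|m IH]; first by rewrite no_visit0.
rewrite no_visitS; apply: measurableI => //; apply: measurableC.
exact: measurable_preiter.
Qed.

Lemma no_visitD k m : no_visit (k + m) = no_visit k `&` (iter k f @^-1` no_visit m).
Proof.
elim: m => [|m IH]; first by rewrite addn0 no_visit0 preimage_setT setIT.
rewrite addnS !no_visitS IH preimage_setI -setIA; do 2 congr (_ `&` _).
by apply/seteqP; split => x; rewrite /setC /preimage /= addnC iterD.
Qed.

Lemma prob_visit_again (k : nat) :
  prob (~` no_visit k `&` (iter k f @^-1` U)) <=
  \sum_(1 <= j < k.+1) prob (U `&` (iter j f @^-1` U)).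
Proof.
pose V j := iter (k - j) f @^-1` (U `&` (iter j f @^-1` U)).
have mUj j : measurable (U `&` (iter j f @^-1` U)).
  by apply: measurableI => //; exact: measurable_preiter.
have mV j : measurable (V j) by exact: measurable_preiter.
pose VU l := [set q | exists2 j, (1 <= j < l.+1)%N & V j q].
have VUS l : VU l.+1 = VU l `|` V l.+1.
  apply/seteqP; split => q /=.
    move=> [j /andP[j1]]; rewrite ltnS leq_eqVlt => /predU1P[->|jl Vj]; first by right.
    by left; exists j => //; rewrite j1.
  move=> [[j /andP[j1 jl] Vj]|Vl]; last by exists l.+1; rewrite // ltnS leqnn.
  by exists j => //; rewrite j1 ltnW.
have VU0 : VU 0 = set0.
  by apply/seteqP; split => // q [j /andP[j1]]; rewrite ltnS leqn0 => /eqP j0; rewrite j0 in j1.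
have mVU l : measurable (VU l).
  by elim: l => [|l IH]; [rewrite VU0|rewrite VUS; exact: measurableU].
have sumVU l : prob (VU l) <= \sum_(1 <= j < l.+1) prob (U `&` (iter j f @^-1` U)).
  elim: l => [|l IH]; first by rewrite VU0 /prob measure0 big_geq.
  rewrite VUS big_nat_recr //=; apply: le_trans (probU_le (mVU l) (mV _)) _.
  by rewrite lerD // prob_preiter.
apply: le_trans (sumVU k); apply: prob_le => //.
  apply: measurableI; last exact: measurable_preiter.
  by apply: measurableC; exact: measurable_no_visit.
move=> q [/= /existsNP[i /not_implyP[ik /contrapT Ui]] Uk].
exists (k - i)%N; first by rewrite subn_gt0 ik ltnS leq_subr.
rewrite /V /preimage /= subKn; last exact: ltnW.
by split => //; rewrite -iterD subnK // ltnW.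
Qed.

Lemma no_visit_block (s t m : nat) (eta sig : R) : (t <= s)%N -> 0 <= eta ->
  (forall j, (t <= j)%N ->
    `|prob (U `&` (iter j f @^-1` no_visit m)) - prob U * prob (no_visit m)| <= eta) ->
  \sum_(1 <= j < s) prob (U `&` (iter j f @^-1` U)) <= sig ->
  `|prob (no_visit (s + m)) - (1 - s%:R * prob U) * prob (no_visit m)|
    <= t%:R * prob U + s%:R * (sig + eta).
Proof.
move=> ts eta0 mix sigP.
have PU0 := prob_ge0 U; have sig0 : 0 <= sig.
  by apply: le_trans sigP; apply: sumr_ge0 => *; exact: prob_ge0.
pose G := iter s f @^-1` no_visit m.
have mW := measurable_no_visit m.
have mG : measurable G by exact: measurable_preiter.
have mH k : measurable (~` no_visit k) by apply: measurableC; exact: measurable_no_visit.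
have mUk k : measurable (iter k f @^-1` U) by exact: measurable_preiter.
pose b k := prob (G `&` ~` no_visit k).
have b0 : b 0%N = 0 by rewrite /b no_visit0 setCT setI0 /prob measure0.
have hitS k : ~` no_visit k.+1 = ~` no_visit k `|` (iter k f @^-1` U).
  by rewrite no_visitS setCI setCK.
have bmono k : b k <= b k.+1.
  apply: prob_le; try exact: measurableI.
  by rewrite hitS; apply: setIS; exact: subsetUl.
have bup k : b k.+1 <= b k + prob (G `&` (iter k f @^-1` U)).
  rewrite /b hitS setIUr; apply: probU_le; exact: measurableI.
have sigk k : (k < s)%N -> prob (~` no_visit k `&` (iter k f @^-1` U)) <= sig.
  move=> ks; apply: le_trans (prob_visit_again k) _; apply: le_trans sigP.
  have [k0|k0] := posnP k.
    by rewrite k0 big_geq //; apply: sumr_ge0 => *; exact: prob_ge0.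
  by rewrite [leRHS](big_cat_nat _ (n := k.+1)) //= lerDl; apply: sumr_ge0 => *; exact: prob_ge0.
have blo k : (k < s)%N -> b k + prob (G `&` (iter k f @^-1` U)) - sig <= b k.+1.
  move=> ks; have mGk : measurable (G `&` (iter k f @^-1` U)) by exact: measurableI.
  have mGh : measurable (G `&` ~` no_visit k) by exact: measurableI.
  have e1 := probDI mGk (mH k).
  have e2 : b k.+1 = prob (G `&` (iter k f @^-1` U) `\` (~` no_visit k)) + b k.
    rewrite /b hitS (probDI (measurableI _ _ mG (measurableU _ _ (mH k) (mUk k))) mGh).
    congr (prob _ + prob _).
      apply/seteqP; split => x.
        move=> [[Gx [nv|Uk]] nGx]; first by exfalso; apply: nGx.
        by split => // nv; apply: nGx.
      by move=> [[Gx Uk] nv]; split; [split => //; right|move=> [_]].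
    apply/seteqP; split => x; first by move=> [].
    by move=> [Gx nv]; split => //; split => //; left.
  have e3 : prob (G `&` (iter k f @^-1` U) `&` ~` no_visit k) <= sig.
    apply: le_trans (sigk k ks); apply: prob_le; [exact: measurableI|exact: measurableI|].
    by move=> x [[_ Uk] nv].
  by rewrite e2 e1; lra.
have gE k : (k <= s)%N -> prob (G `&` (iter k f @^-1` U)) =
    prob (U `&` (iter (s - k) f @^-1` no_visit m)).
  move=> ks; rewrite -(prob_preiter k (A := U `&` _)); last first.
    by apply: measurableI => //; exact: measurable_preiter.
  congr prob; rewrite preimage_setI setIC; congr (_ `&` _).
  by apply/seteqP; split => x; rewrite /G /preimage /= -iterD subnK.
set a := prob (no_visit m) in mix *.
have a0 : 0 <= a by exact: prob_ge0.
have a1 : a <= 1 by exact: prob_le1.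
have main k : (k <= s - t)%N -> `|b k - k%:R * (prob U * a)| <= k%:R * (eta + sig).
  elim: k => [|k IH] kst; first by rewrite b0 !mul0r subrr normr0.
  have ks : (k < s)%N by apply: leq_trans kst _; exact: leq_subr.
  have := IH (ltnW kst); have := blo _ ks; have := bup k; rewrite gE; last exact: ltnW.
  have /mix : (t <= s - k)%N.
    by rewrite leq_subRL ?(ltnW ks) // addnC -leq_subRL // ltnW.
  rewrite !ler_norml -natr1 => /andP[h1 h2] h3 h4 /andP[h5 h6].
  by apply/andP; split; lra.
have tail k : b (s - t)%N <= b (s - t + k)%N <= b (s - t)%N + k%:R * prob U.
  elim: k => [|k /andP[IH1 IH2]]; first by rewrite addn0 mul0r addr0 lexx.
  rewrite addnS; apply/andP; split; first exact: le_trans IH1 (bmono _).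
  apply: le_trans (bup _) _; rewrite -natr1 mulrDl mul1r addrA lerD //.
  rewrite -(prob_preiter (s - t + k) mU); apply: prob_le => //; exact: measurableI.
have bs := tail t; rewrite subnK // in bs.
have -> : prob (no_visit (s + m)) = a - b s.
  have aE : a = prob G by rewrite prob_preiter.
  rewrite aE (probDI mG (mH s)) addrK; congr prob.
  by rewrite no_visitD setDE setCK setIC.
have := main _ (leqnn (s - t)); rewrite natrB // => hm.
have sR : (t%:R : R) <= s%:R by rewrite ler_nat.
have t0 : 0 <= t%:R :> R by [].
have Ua : prob U * a <= prob U by rewrite ler_piMr.
have Ua0 : 0 <= prob U * a by rewrite mulr_ge0.
have es0 : 0 <= eta + sig by rewrite addr_ge0.
move: hm bs; rewrite !ler_norml => /andP[h1 h2] /andP[h3 h4].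
have tes : 0 <= t%:R * (eta + sig) by rewrite mulr_ge0.
have tUa : t%:R * (prob U * a) <= t%:R * prob U by rewrite ler_wpM2l.
have tUa0 : 0 <= t%:R * (prob U * a) by rewrite mulr_ge0.
by apply/andP; split; lra.
Qed.

Theorem no_visit_poisson (s t n : nat) (eta sig : R) : (0 < s)%N -> (t <= s)%N ->
  0 <= eta -> s%:R * prob U <= 1 ->
  (forall m j, (t <= j)%N ->
    `|prob (U `&` (iter j f @^-1` no_visit m)) - prob U * prob (no_visit m)| <= eta) ->
  \sum_(1 <= j < s) prob (U `&` (iter j f @^-1` U)) <= sig ->
  `|prob (no_visit n) - expR (- (n%:R * prob U))| <=
    2 * (s%:R * prob U) + n%:R * prob U * (t%:R / s%:R) + n%:R * (sig + eta)
    + n%:R * prob U * (s%:R * prob U).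
Proof.
move=> s_gt0 ts eta0 sU1 mix sigP.
have PU0 := prob_ge0 U; have sig0 : 0 <= sig.
  by apply: le_trans sigP; apply: sumr_ge0 => *; exact: prob_ge0.
set x := s%:R * prob U in sU1 *.
have sR0 : 0 < s%:R :> R by rewrite ltr0n.
have x0 : 0 <= x by rewrite mulr_ge0.
have x01 : 0 <= x <= 1 by rewrite x0.
pose q := (n %/ s)%N; pose r := (n %% s)%N.
have nE : n = (q * s + r)%N by exact: divn_eq.
have rs : (r%:R : R) <= s%:R by rewrite ler_nat ltnW // ltn_mod.
have r0 : 0 <= r%:R :> R by [].
have q0 : 0 <= q%:R :> R by [].
have nR : n%:R = q%:R * s%:R + r%:R :> R by rewrite {1}nE natrD natrM.
have h1 := recursion_bound q x01 (a := fun m => prob (no_visit m))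
  (eq_trans (congr1 prob no_visit0) prob_setT)
  (fun m => no_visit_block ts eta0 (mix m) sigP).
have h2 : `|(1 - x) ^+ q - expR (- x) ^+ q| <= q%:R * x ^+ 2.
  apply: le_trans (exprB_le q _ _) _.
  - by lra.
  - by rewrite ltW ?expR_gt0 //= -expR0 ler_expR oppr_le0.
  - by apply: ler_wpM2l => //; exact: expRN_quadratic.
have h3 : `|expR (- x) ^+ q - expR (- (n%:R * prob U))| <= x.
  rewrite -expRM_natl mulrN; apply: le_trans (expRN_lipschitz _ _) _.
  - by rewrite mulr_ge0.
  - by rewrite mulr_ge0.
  rewrite nR /x (_ : _ - _ = - (r%:R * prob U)); last by ring.
  by rewrite normrN ger0_norm ?mulr_ge0 // ler_wpM2r.
have h4 : `|prob (no_visit n) - prob (no_visit (q * s))| <= x.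
  have mqs := measurable_no_visit (q * s).
  have tail k : prob (no_visit (q * s)) - k%:R * prob U <= prob (no_visit (q * s + k)).
    elim: k => [|k IH]; first by rewrite addn0 mul0r subr0.
    rewrite addnS no_visitS -natr1.
    have mUk : measurable (iter (q * s + k) f @^-1` U) by exact: measurable_preiter.
    have := probDI (measurable_no_visit (q * s + k)) mUk.
    rewrite setDE.
    have : prob (no_visit (q * s + k) `&` iter (q * s + k) f @^-1` U) <= prob U.
      rewrite -[leRHS](prob_preiter (q * s + k) mU); apply: prob_le => //.
      by apply: measurableI => //; exact: measurable_no_visit.
    lra.
  have up : prob (no_visit n) <= prob (no_visit (q * s)).
    apply: prob_le => //; first exact: measurable_no_visit.
    by rewrite nE no_visitD; exact: subIsetl.
  have := tail r; rewrite -nE => tl.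
  rewrite distrC ger0_norm ?subr_ge0 //; apply: (@le_trans _ _ (r%:R * prob U)).
    lra.
  by rewrite ler_wpM2r.
have tri : `|prob (no_visit n) - expR (- (n%:R * prob U))| <=
    x + q%:R * (t%:R * prob U + s%:R * (sig + eta)) + q%:R * x ^+ 2 + x.
  have -> : prob (no_visit n) - expR (- (n%:R * prob U)) =
     (prob (no_visit n) - prob (no_visit (q * s))) +
     (prob (no_visit (q * s)) - (1 - x) ^+ q) +
     ((1 - x) ^+ q - expR (- x) ^+ q) +
     (expR (- x) ^+ q - expR (- (n%:R * prob U))) by ring.
  by rewrite !(le_trans (ler_normD _ _)) // !lerD // !(le_trans (ler_normD _ _)) // !lerD //
     (le_trans (ler_normD _ _)) // lerD.
apply: le_trans tri _.
have qsn : q%:R * s%:R <= n%:R :> R by rewrite nR lerDl.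
have t1 : q%:R * (t%:R * prob U) <= n%:R * prob U * (t%:R / s%:R).
  rewrite (_ : n%:R * _ * _ = n%:R * (prob U * t%:R) / s%:R); last by ring.
  rewrite ler_pdivlMr // (_ : _ * s%:R = q%:R * s%:R * (prob U * t%:R)); last by ring.
  by rewrite ler_wpM2r ?mulr_ge0.
have t2 : q%:R * (s%:R * (sig + eta)) <= n%:R * (sig + eta).
  by rewrite mulrA ler_wpM2r ?addr_ge0.
have t3 : q%:R * x ^+ 2 <= n%:R * prob U * x.
  rewrite (_ : q%:R * x ^+ 2 = q%:R * s%:R * (prob U * x)); last by rewrite /x; ring.
  by rewrite -[leRHS]mulrA ler_wpM2r ?mulr_ge0.
lra.
Qed.

End no_visit.

(** * Decorrelation of balls *)

Section bump.
Context {R : realType}.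

Definition bump (r w x : R) : R := Num.min 1 (Num.max 0 (1 + (r - x) / w)).

Lemma bump01 (r w x : R) : 0 <= bump r w x <= 1.
Proof. by rewrite /bump le_min ler01 le_max lexx /= ge_min lexx. Qed.

Lemma bump_eq1 (r w x : R) : 0 < w -> x <= r -> bump r w x = 1.
Proof.
move=> w0 xr; rewrite /bump min_l // le_max lerDl divr_ge0 ?orbT ?subr_ge0 //.
exact: ltW.
Qed.

Lemma bump_eq0 (r w x : R) : 0 < w -> r + w < x -> bump r w x = 0.
Proof.
move=> w0 xr; rewrite /bump max_l ?min_r //.
by rewrite -lerBrDl sub0r ler_pdivrMr // mulN1r; lra.
Qed.

Lemma bump_lipschitz (r w x y : R) : 0 < w -> `|bump r w x - bump r w y| <= `|x - y| / w.
Proof.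
move=> w0; have -> : `|x - y| / w = `|(1 + (r - x) / w) - (1 + (r - y) / w)|.
  rewrite (_ : 1 + _ - _ = (y - x) / w); last by ring.
  by rewrite normrM distrC [`|w^-1|]gtr0_norm // invr_gt0.
rewrite /bump; set a := 1 + _; set b := 1 + _.
have := ler_norm (a - b); have := ler_norm (- (a - b)); rewrite normrN => h1 h2.
rewrite ler_norml; apply/andP; split; rewrite /Num.min /Num.max /Order.min /Order.max;
  case: (ltP 0 a) => ha; case: (ltP 0 b) => hb;
  rewrite ?ltr10;
  repeat match goal with |- context [if ?c then _ else _] => case: ifP => ? end; lra.
Qed.

Lemma sup_le_ge0 (S : set R) (c : R) : 0 <= c -> ubound S c -> sup S <= c.
Proof.
move=> c0 Sc; have [->|/set0P S0] := eqVneq S set0; first by rewrite sup0.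
exact: ge_sup.
Qed.

Lemma sup_nonneg (S : set R) (c : R) : (forall x, S x -> 0 <= x) -> ubound S c -> 0 <= sup S.
Proof.
move=> S0 Sc; have [->|/set0P [x Sx]] := eqVneq S set0; first by rewrite sup0.
by apply: le_trans (S0 _ Sx) _; apply: ub_le_sup => //; exists c.
Qed.

End bump.

Section decorrelation.
Context {R : realType} {d1 d2 : measure_display}.
Context {X : borelMetricType R d1} {Y : borelMetricType R d2}.
Hypotheses (cX : compact [set: X]) (cY : compact [set: Y]).

Definition pcball (p : X * Y) (r : R) : set (X * Y) := [set q | pdist p q <= r].

Lemma measurable_pcball (p : X * Y) (r : R) : measurable (pcball p r).
Proof.
rewrite -[pcball _ _]setTI /pcball -preimage_itvNyc; exact: measurable_pdist.
Qed.

Lemma pdist_bump_hoelder (p : X * Y) (r w a : R) : 0 < w <= 1 -> 0 < a <= 1 ->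
  forall q s, `|bump r w (pdist p q) - bump r w (pdist p s)| <= w^-1 * pdist q s `^ a.
Proof.
move=> /andP[w0 w1] /andP[a0 a1] q s.
have [rxx rsym rtri _] := pdist_separable cX cY.
have d0 : 0 <= pdist q s by exact: sqrtr_ge0.
have lip : `|bump r w (pdist p q) - bump r w (pdist p s)| <= pdist q s / w.
  apply: le_trans (bump_lipschitz _ _ _ w0) _; rewrite ler_wpM2r ?invr_ge0 ?(ltW w0) //.
  have := rtri p q s; have := rtri p s q; rewrite (rsym s q) => h1 h2.
  by rewrite ler_norml; apply/andP; split; lra.
have le1 : `|bump r w (pdist p q) - bump r w (pdist p s)| <= 1.
  have := bump01 r w (pdist p q); have := bump01 r w (pdist p s).
  move=> /andP[? ?] /andP[? ?].
  by rewrite ler_norml; apply/andP; split; lra.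
have wV : 1 <= w^-1 by rewrite invf_ge1.
have [d00|dn0] := eqVneq (pdist q s) 0.
  by apply: le_trans lip _; rewrite d00 mul0r mulr_ge0 ?powR_ge0 // invr_ge0 ltW.
have dpos : 0 < pdist q s by rewrite lt0r dn0.
have [dle1|dgt1] := leP (pdist q s) 1.
  apply: le_trans lip _; rewrite mulrC ler_wpM2l ?invr_ge0 ?(ltW w0) //.
  by apply: ger1_powR; rewrite ?dpos.
apply: le_trans le1 _; rewrite -[leLHS]mulr1; apply: ler_pM => //.
by rewrite -[leLHS](powRr0 (pdist q s)) ler_powR // ltW.
Qed.

Lemma hoelder_norm_bump (p : X * Y) (r w a : R) : 0 < w <= 1 -> 0 < a <= 1 ->
  0 <= hoelder_norm a (fun q => bump r w (pdist p q)) <= 2 / w.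
Proof.
move=> /[dup] w01 /andP[w0 w1] /[dup] a01 /andP[a0 a1].
have wV : 1 <= w^-1 by rewrite invf_ge1.
rewrite /hoelder_norm; set A := [set _ | _ in _]; set B := [set _ | _].
have ubA : ubound A 1.
  by move=> _ [q _ <-]; have /andP[? ?] := bump01 r w (pdist p q); rewrite ger0_norm.
have ubB : ubound B w^-1.
  move=> _ [q [s [_ ->]]]; have hh := pdist_bump_hoelder p r w01 a01 q s.
  have [z|nz] := eqVneq (pdist q s `^ a) 0.
    by rewrite z invr0 mulr0 invr_ge0 ltW.
  by rewrite ler_pdivrMr // lt0r nz powR_ge0.
apply/andP; split; first apply: addr_ge0.
- by apply: (sup_nonneg _ ubA) => _ [q _ <-].
- by apply: (sup_nonneg _ ubB) => _ [q [s [_ ->]]]; rewrite divr_ge0 ?powR_ge0.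
- rewrite mulrDl mul1r lerD //.
    by apply: sup_le_ge0; [rewrite invr_ge0 ltW|move=> x /ubA x1; exact: le_trans wV].
  by apply: sup_le_ge0; rewrite ?invr_ge0 ?(ltW w0).
Qed.

Lemma Lnorm_indic_le1 d (Z : measurableType d) (nu : probability Z R) (W : set Z) :
  ('N[nu]_+oo[EFin \o \1_W] <= 1)%E.
Proof.
rewrite unlock; case: ifP => // _; apply/ess_supP; apply: aeW => x /=.
by rewrite indicE lee_fin; case: (_ \in _); rewrite ?normr1 ?normr0.
Qed.

Variables (nu : probability (X * Y)%type R) (F : X * Y -> X * Y).
Hypothesis mF : measurable_fun setT F.
Variables (ahat C2 alpha : R) (Theta : nat -> R).
Hypotheses (ahat01 : 0 < ahat <= 1) (C2_gt0 : 0 < C2).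
Hypothesis decay : forall (Ups Psi : X * Y -> R), hoelder_continuous ahat Ups ->
  measurable_fun setT Psi -> ('N[nu]_+oo[EFin \o Psi] < +oo)%E ->
  forall j : nat, (1 <= j)%N ->
  `| \int[nu]_q (Psi (iter j F q) * Ups q) - (\int[nu]_q Ups q) * (\int[nu]_q Psi q) |
  <= C2 * Theta j * fine ('N[nu]_+oo[EFin \o Psi])%E * hoelder_norm ahat Ups.
Hypothesis Theta_le : forall j : nat, (1 <= j)%N -> Theta j <= j%:R `^ (- alpha).

Let prob_indic (W : set (X * Y)) : measurable W ->
  \int[nu]_q (\1_W q) = prob nu W.
Proof. by move=> mW; rewrite /Rintegral /prob integral_indic // setIT. Qed.

Let integrable_bounded (g : X * Y -> R) : measurable_fun setT g ->
  (forall q, 0 <= g q <= 1) -> nu.-integrable setT (EFin \o g).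
Proof.
move=> mg g01; apply: (le_integrable measurableT (g := cst 1%E)) => //.
- exact/measurable_EFinP.
- by move=> q _ /=; have /andP[? ?] := g01 q; rewrite lee_fin !ger0_norm.
- exact: finite_measure_integrable_cst.
Qed.

Lemma decorrelation (p : X * Y) (r w : R) (W : set (X * Y)) (j : nat) :
  0 < w <= 1 -> measurable W -> (1 <= j)%N ->
  prob nu (pcball p r) * prob nu W - (prob nu (pcball p (r + w)) - prob nu (pcball p r))
    - C2 * j%:R `^ (- alpha) * (2 / w) <=
  prob nu (pcball p r `&` (iter j F @^-1` W)) <=
  prob nu (pcball p (r + w)) * prob nu W + C2 * j%:R `^ (- alpha) * (2 / w).
Proof.
move=> /[dup] w01 /andP[w0 w1] mW j1.
set e := _ * (2 / w); set U := pcball p r; set U' := pcball p (r + w).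
have mU : measurable U by exact: measurable_pcball.
have mU' : measurable U' by exact: measurable_pcball.
pose Ups q := bump r w (pdist p q); pose Psi : X * Y -> R := \1_W.
have mUps : measurable_fun setT Ups.
  apply: measurable_minr => //; apply: measurable_maxr => //.
  apply: measurable_funD => //; apply: measurable_funM => //.
  by apply: measurable_funB => //; exact: measurable_pdist.
have mPsi : measurable_fun setT Psi by exact: measurable_indic.
have mPsij : measurable_fun setT (fun q => Psi (iter j F q)).
  by apply: measurableT_comp => //; exact: measurable_iter.
have U01 q : 0 <= Ups q <= 1 by exact: bump01.
have P01 q : 0 <= Psi q <= 1 by rewrite /Psi indicE; case: (_ \in _); rewrite ?lexx ?ler01.
have PU01 q : 0 <= Psi (iter j F q) * Ups q <= 1.
  have /andP[? ?] := U01 q; have /andP[? ?] := P01 (iter j F q).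
  by rewrite mulr_ge0 // mulr_ile1.
have iU : nu.-integrable setT (EFin \o Ups) by exact: integrable_bounded.
have iPU : nu.-integrable setT (EFin \o (fun q => Psi (iter j F q) * Ups q)).
  by apply: integrable_bounded => //; exact: measurable_funM.
have iInd (V : set (X * Y)) : measurable V -> nu.-integrable setT (EFin \o (\1_V : X * Y -> R)).
  move=> mV; apply: integrable_bounded; first exact: measurable_indic.
  by move=> q; rewrite indicE; case: (_ \in _); rewrite ?lexx ?ler01.
have Ulo q : (\1_U q : R) <= Ups q.
  rewrite indicE; case: (boolP (_ \in _)) => [/set_mem qU|_]; last by case/andP: (U01 q).
  by rewrite /Ups bump_eq1.
have Uhi q : Ups q <= \1_U' q.
  rewrite indicE; case: (boolP (_ \in _)) => [_|/negP qU]; first by case/andP: (U01 q).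
  rewrite /Ups bump_eq0 // ltNge; apply/negP => h; apply: qU; exact: mem_set.
have mWj : measurable (iter j F @^-1` W) by exact: measurable_preiter.
have mUW : measurable (U `&` (iter j F @^-1` W)) by exact: measurableI.
have mUW' : measurable (U' `&` (iter j F @^-1` W)) by exact: measurableI.
have I1 : prob nu U <= \int[nu]_q Ups q.
  by rewrite -prob_indic //; apply: le_Rintegral => //; exact: iInd.
have I2 : \int[nu]_q Ups q <= prob nu U'.
  by rewrite -prob_indic //; apply: le_Rintegral => //; exact: iInd.
have indI (V : set (X * Y)) q : (\1_(V `&` (iter j F @^-1` W)) q : R) = Psi (iter j F q) * \1_V q.
  by rewrite indicI /= mulrC.
have J1 : prob nu (U `&` (iter j F @^-1` W)) <= \int[nu]_q (Psi (iter j F q) * Ups q).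
  rewrite -prob_indic //; apply: le_Rintegral => //; first exact: iInd.
  by move=> q _; rewrite indI ler_wpM2l //; case/andP: (P01 (iter j F q)).
have J2 : \int[nu]_q (Psi (iter j F q) * Ups q) <= prob nu (U' `&` (iter j F @^-1` W)).
  rewrite -prob_indic //; apply: le_Rintegral => //; first exact: iInd.
  by move=> q _; rewrite indI ler_wpM2l //; case/andP: (P01 (iter j F q)).
have hold : hoelder_continuous ahat Ups.
  by exists w^-1; exact: pdist_bump_hoelder.
have N1 := Lnorm_indic_le1 nu W.
have N0 := Lnorm_ge0 nu +oo (EFin \o (\1_W : X * Y -> R)).
have Nfin : ('N[nu]_+oo[EFin \o Psi] < +oo)%E by apply: le_lt_trans N1 _; exact: ltry.
have := decay hold mPsi Nfin j1; rewrite prob_indic // => dec.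
have {}dec : `| \int[nu]_q (Psi (iter j F q) * Ups q) - (\int[nu]_q Ups q) * prob nu W | <= e.
  apply: le_trans dec _.
  have /andP[h0 h1] := hoelder_norm_bump p r w01 ahat01.
  have f0 : 0 <= fine ('N[nu]_+oo[EFin \o Psi])%E by exact: fine_ge0.
  have f1 : fine ('N[nu]_+oo[EFin \o Psi])%E <= 1.
    by rewrite -lee_fin fineK // ge0_fin_numE.
  have jp : 0 <= j%:R `^ (- alpha) by exact: powR_ge0.
  apply: (@le_trans _ _ (C2 * j%:R `^ (- alpha) * fine ('N[nu]_+oo[EFin \o Psi])%E
    * hoelder_norm ahat Ups)).
    rewrite ler_wpM2r // ler_wpM2r // ler_wpM2l ?(ltW C2_gt0) //; exact: Theta_le.
  have c0 : 0 <= C2 * j%:R `^ (- alpha) by rewrite mulr_ge0 // ltW.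
  rewrite /e -mulrA ler_wpM2l // -[leRHS]mul1r; exact: ler_pM.
have PW0 := prob_ge0 nu W; have PW1 := prob_le1 nu mW.
have PU0 := prob_ge0 nu U.
move: dec; rewrite ler_norml => /andP[d1' d2'].
have diff : prob nu (U' `&` (iter j F @^-1` W)) <=
    prob nu (U `&` (iter j F @^-1` W)) + (prob nu U' - prob nu U).
  have sUU : U `<=` U' by move=> q /= h; apply: le_trans h _; rewrite lerDl ltW.
  have mD : measurable (U' `\` U) by exact: measurableD.
  rewrite (probDI nu mU' mU) (_ : U' `&` U = U); last by apply/setIidPr.
  rewrite addrK; apply: le_trans (probU_le nu mUW mD); apply: prob_le => //.
    exact: measurableU.
  by move=> q [qU' qW]; have [qU|nqU] := pselect (U q); [left|right].
have k1 : prob nu U * prob nu W <= (\int[nu]_q Ups q) * prob nu W by rewrite ler_wpM2r.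
have k2 : (\int[nu]_q Ups q) * prob nu W <= prob nu U' * prob nu W by rewrite ler_wpM2r.
by apply/andP; split; lra.
Qed.

End decorrelation.

(** * Passage to the limit *)

Section sequences.
Context {R : realType}.

Lemma cvg_at_right_seq (f : R -> R) (l : R) (u : nat -> R) :
  f r @[r --> 0^'+] --> l -> (\forall n \near \oo, 0 < u n) ->
  u n @[n --> \oo] --> 0 -> f (u n) @[n --> \oo] --> l.
Proof.
move=> /cvgr_dist_le fl u0 ul; apply/cvgrPdist_le => e e0.
have [d /= d0 hd] := fl e e0.
have ud : \forall n \near \oo, `|0 - u n| < d by move: ul => /cvgr_dist_lt; exact.
apply: filterS2 u0 ud => n un0; rewrite sub0r normrN => und.
by apply: hd => //=; rewrite sub0r normrN.
Qed.

Lemma cvg_natV : (n%:R^-1 : R) @[n --> \oo] --> 0.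
Proof. by rewrite -cvg_shiftS; exact: cvg_harmonic. Qed.

Lemma cvg_natpowRN (a : R) : 0 < a -> (n%:R `^ (- a) : R) @[n --> \oo] --> 0.
Proof.
move=> a0; have := cvg_at_right_seq (powR_cvg0 a0) _ cvg_natV.
have nn : \forall n \near \oo, 0 < n%:R^-1 :> R.
  by exists 1%N => // n /= n1; rewrite invr_gt0 ltr0n.
move=> /(_ nn); apply: cvg_trans; apply: near_eq_cvg.
by apply: nearW => n; rewrite -powR_inv1 // -powRrM mulN1r.
Qed.

Lemma sum_two_bounds (a : nat -> R) (s t : nat) (A B : R) :
  (forall j, (1 <= j <= t)%N -> a j <= A) -> (forall j, (t < j)%N -> a j <= B) ->
  0 <= A -> 0 <= B -> \sum_(1 <= j < s) a j <= t%:R * A + s%:R * B.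
Proof.
move=> aA aB A0 B0.
have main m : \sum_(1 <= j < m.+1) a j <= (minn m t)%:R * A + m%:R * B.
  elim: m => [|m IH]; first by rewrite big_geq // min0n !mul0r addr0.
  rewrite big_nat_recr //=; have [mt|tm] := leqP m.+1 t.
    have := aA m.+1; rewrite mt => /(_ isT) h; move: IH.
    by rewrite (minn_idPl (ltnW mt)) -!natr1 => IH; lra.
  have := aB _ tm; move: IH; rewrite ltnS in tm.
  by rewrite (minn_idPr tm) -[m.+1%:R]natr1; lra.
case: s => [|s]; first by rewrite big_geq // addr_ge0 ?mulr_ge0.
apply: le_trans (main s) _; apply: lerD; apply: ler_wpM2r => //.
  by rewrite ler_nat geq_minr.
by rewrite ler_nat.
Qed.

Lemma nat_floor_half (x : R) : 1 <= x -> exists s : nat,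
  [/\ (1 <= s)%N, s%:R <= x, x / 2 <= s%:R & forall m : nat, m%:R <= x -> (m <= s)%N].
Proof.
move=> x1; have x0 : 0 <= x by rewrite (le_trans ler01).
have /andP[t1 t2] : (Num.truncn x)%:R <= x < (Num.truncn x).+1%:R by rewrite truncn_itv.
have tp : (1 <= Num.truncn x)%N.
  by rewrite -ltnS -(ltr_nat R); apply: le_lt_trans t2.
have tpR : (1 : R) <= (Num.truncn x)%:R by rewrite ler1n.
exists (Num.truncn x); split => //; first by move: t2; rewrite -natr1; lra.
by move=> m; rewrite truncn_ge_nat.
Qed.

Lemma dyadic_floor_half (y : R) : 1 <= y -> exists k : nat,
  [/\ (2 ^ k)%:R <= y, y / 2 <= (2 ^ k)%:R & forall j, (2 ^ j)%:R <= y -> (j <= k)%N].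
Proof.
move=> y1; have y0 : 0 <= y by rewrite (le_trans ler01).
have tp : (0 < Num.truncn y)%N by rewrite truncn_ge_nat.
have /andP[kt tk] := trunc_log_bounds (isT : (1 < 2)%N) tp.
exists (trunc_log 2 (Num.truncn y)); split.
- by rewrite -truncn_ge_nat.
- have /andP[_ t2] : (Num.truncn y)%:R <= y < (Num.truncn y).+1%:R by rewrite truncn_itv.
  rewrite ler_pdivrMr //; apply: le_trans (ltW t2) _.
  by rewrite -natrM ler_nat mulnC -expnS.
- by move=> j jy; apply: trunc_log_max => //; rewrite truncn_ge_nat.
Qed.

End sequences.

Section Zmax.
Context {R : realType} {d1 d2 : measure_display}.
Context {X : borelMetricType R d1} {Y : borelMetricType R d2}.

Lemma bigmaxe_ltP (a : nat -> \bar R) (c : R) (m : nat) :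
  (\big[maxe/-oo%E]_(i < m) a i < c%:E)%E <-> forall i, (i < m)%N -> (a i < c%:E)%E.
Proof.
elim: m => [|m IH]; first by rewrite big_ord0 ltNyr; split.
rewrite big_ord_recr /= gt_max; split => [/andP[/IH h hm] i|h].
  by rewrite ltnS leq_eqVlt => /predU1P[->//|]; exact: h.
by apply/andP; split; [apply/IH => i im; apply: h; exact: ltnW|exact: h].
Qed.

Lemma Phi_lt (p q : X * Y) (c : R) : (Phi p q < c%:E)%E <-> expR (- c) < pdist q p.
Proof.
have d0 : 0 <= pdist q p by exact: sqrtr_ge0.
rewrite /Phi; have [dz|dp] := eqVneq (pdist q p) 0.
  rewrite dz le0_lneNy // ltNge leey /=; split => // h.
  by have := expR_gt0 (- c); lra.
have dpos : 0 < pdist q p by rewrite lt0r dp.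
rewrite lne_EFin // -EFinN lte_fin -{2}(lnK dpos) ltr_expR; split; lra.
Qed.

Lemma Zmax_ltE (cX : compact [set: X]) (cY : compact [set: Y])
    (F : X * Y -> X * Y) (p : X * Y) (n : nat) (c : R) :
  [set q | (Zmax F p n q < c%:E)%E] = no_visit F (pcball p (expR (- c))) n.+1.
Proof.
have [_ rsym _ _] := pdist_separable cX cY.
apply/seteqP; split => q /=.
  move=> /(bigmaxe_ltP (fun i => Phi p (iter i F q))) h i im; have /Phi_lt := h i im.
  by rewrite /pcball /= rsym ltNge => /negP.
move=> h; apply/(bigmaxe_ltP (fun i => Phi p (iter i F q))) => i im; apply/Phi_lt.
by rewrite ltNge; apply/negP => hh; apply: (h i im); rewrite /pcball /= rsym.
Qed.

Lemma measurable_short_return (cX : compact [set: X]) (T : X -> X) (g : nat -> R) (n : nat) :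
  measurable_fun setT T -> measurable (short_return T g n).
Proof.
move=> mT.
have -> : short_return T g n =
    \bigcup_(j in [set j | (1 <= j)%N /\ j%:R <= g n])
      [set x | mdist (iter j T x) x < n%:R^-1].
  apply/seteqP; split => x; first by move=> [j [? ? ?]]; exists j.
  by move=> [j [? ?] ?]; exists j.
apply: bigcup_measurable => j _; apply: (measurable_mdist_lt cX) => //.
exact: measurable_iter.
Qed.

Lemma return_short (T : X -> X) (u : X * Y -> Y) (g : nat -> R) (p : X * Y) (r : R)
    (j m : nat) : compact [set: X] -> compact [set: Y] ->
  (1 <= j)%N -> j%:R <= g m -> 2 * r < m%:R^-1 ->
  pcball p r `&` (iter j (skew_ext T u) @^-1` pcball p r) `<=`
  pcball p r `&` (fst @^-1` short_return T g m).
Proof.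
move=> cX cY j1 jg rm q [qr qj]; split => //; exists j; split => //.
have [_ rsym rtri _] := pdist_separable cX cY.
have fstE i : (iter i (skew_ext T u) q).1 = iter i T q.1.
  by elim: i => [//|i IH]; rewrite !iterS -IH.
rewrite -fstE; apply: le_lt_trans (pdist_ge_fst _ q) _.
apply: le_lt_trans (rtri _ p _) _; rewrite (rsym _ p).
by move: qr qj; rewrite /pcball /preimage /=; lra.
Qed.

End Zmax.

Section scaling.
Context {R : realType}.
Variables (D : nat) (v : R).
Hypothesis D0 : (0 < D)%N.

Definition radius_seq (n : nat) : R := expR (- v) * n%:R `^ (- D%:R^-1).

Lemma radius_seq_gt0 n : (0 < n)%N -> 0 < radius_seq n.
Proof. by move=> n0; rewrite mulr_gt0 ?expR_gt0 ?powR_gt0 ?ltr0n. Qed.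

Lemma radius_seqE n : (0 < n)%N -> radius_seq n = expR (- (v + D%:R^-1 * ln n%:R)).
Proof.
by move=> n0; rewrite opprD expRD /radius_seq /powR pnatr_eq0 eqn0Ngt n0 /= mulNr.
Qed.

Lemma radius_seq_expn n : (0 < n)%N ->
  n%:R * radius_seq n ^+ D = expR (- (D%:R * v)).
Proof.
move=> n0; have nR : (0 : R) < n%:R by rewrite ltr0n.
have DR : (0 : R) < D%:R by rewrite ltr0n.
rewrite exprMn -expRM_natl mulrN -[X in _ * (_ * X)]powR_mulrn ?powR_ge0 //.
rewrite -powRrM mulNr mulVf ?gt_eqF // powR_inv1 ?ltW //.
by rewrite mulrCA mulfV ?mulr1 // gt_eqF.
Qed.

Lemma radius_seq_cvg0 : radius_seq n @[n --> \oo] --> 0.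
Proof.
rewrite -(mulr0 (expR (- v))); apply: cvgM; first exact: cvg_cst.
by apply: cvg_natpowRN; rewrite invr_gt0 ltr0n.
Qed.

Lemma scaled_cvg (m : R -> R) (L : R) (phi : nat -> R) :
  m r / r ^+ D @[r --> 0^'+] --> L -> (\forall n \near \oo, 0 < phi n) ->
  phi n @[n --> \oo] --> (1 : R) ->
  n%:R * m (radius_seq n * phi n) @[n --> \oo] --> L * expR (- (D%:R * v)).
Proof.
move=> mL phi0 phi1.
have npos : \forall n \near \oo, (0 < n)%N by exists 1%N.
have rphi : radius_seq n * phi n @[n --> \oo] --> 0.
  by rewrite -(mul0r (1 : R)); apply: cvgM => //; exact: radius_seq_cvg0.
have rpos : \forall n \near \oo, 0 < radius_seq n * phi n.
  by apply: filterS2 npos phi0 => n n0 p0; rewrite mulr_gt0 ?radius_seq_gt0.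
have h := cvg_at_right_seq mL rpos rphi.
have phiD : phi n ^+ D @[n --> \oo] --> (1 ^+ D : R).
  exact: (cvg_comp _ _ phi1 (@exprn_continuous R D 1)).
rewrite expr1n in phiD.
have tot : m (radius_seq n * phi n) / (radius_seq n * phi n) ^+ D *
    (expR (- (D%:R * v)) * phi n ^+ D) @[n --> \oo] --> L * (expR (- (D%:R * v)) * 1).
  by apply: cvgM => //; apply: cvgM => //; exact: cvg_cst.
rewrite mulr1 in tot; apply: cvg_trans tot; apply: near_eq_cvg.
apply: filterS2 npos rpos => n n0 p0.
have -> : expR (- (D%:R * v)) * phi n ^+ D = n%:R * (radius_seq n * phi n) ^+ D.
  by rewrite -(radius_seq_expn n0) -mulrA -exprMn.
by rewrite mulrCA divfK // expf_neq0 // gt_eqF.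
Qed.

End scaling.

Section error.
Context {R : realType}.

Lemma error_cvg0 (x x' : nat -> R) (L a c e K1 K2 : R) :
  x n @[n --> \oo] --> L -> x' n @[n --> \oo] --> L -> 0 < a -> 0 < c -> 0 < e ->
  2 * (n%:R `^ (- 2^-1) * x n) + 4 * (x n * n%:R `^ (- a)) + 2 * (x' n - x n) +
    K1 * n%:R `^ (- c) + 2 * (n%:R `^ (- 2^-1) * (x' n * x n)) +
    K2 * n%:R `^ (- e) + 2 * (x n * (n%:R `^ (- 2^-1) * x n)) @[n --> \oo] --> 0.
Proof.
move=> xL x'L a0 c0 e0.
have zh : (n%:R `^ (- 2^-1) : R) @[n --> \oo] --> 0 by exact: cvg_natpowRN.
have za := cvg_natpowRN a0; have zc := cvg_natpowRN c0; have ze := cvg_natpowRN e0.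
have -> : 0 = 2 * (0 * L) + 4 * (L * 0) + 2 * (L - L) + K1 * 0 + 2 * (0 * (L * L)) +
   K2 * 0 + 2 * (L * (0 * L)) :> R by ring.
have cM (k l : R) (y : nat -> R) : y n @[n --> \oo] --> l -> k * y n @[n --> \oo] --> k * l.
  by move=> yl; apply: cvgM => //; exact: cvg_cst.
apply: cvgD; last by apply: cM; apply: cvgM => //; exact: cvgM.
apply: cvgD; last exact: cM.
apply: cvgD; last by apply: cM; apply: cvgM => //; exact: cvgM.
apply: cvgD; last exact: cM.
apply: cvgD; last by apply: cM; exact: cvgB.
by apply: cvgD; apply: cM; exact: cvgM.
Qed.

End error.

(* Applied with N = n, h = n^{-1/2}, Nb = n^b, Nb' = n^{-b'}: A bounds
   nu(U_n, f^-j U_n) for j <= t, and e is the error in the decay of correlations. *)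
Lemma error_bound {R : realType} (N h PU PU' s t A e Nb Nb' Zc K1 K3 : R) :
  1 <= N -> 0 < h -> N * h * h = 1 -> 0 <= PU -> PU <= PU' ->
  1 <= s -> s <= N * h -> N * h / 2 <= s -> 0 <= t -> t <= Nb ->
  0 <= A -> N * A <= K3 * Nb' -> 0 <= e -> N * (N * h) * e <= K1 * Zc ->
  2 * (s * PU) + (N + 1) * PU * (t / s) +
    (N + 1) * (t * A + s * (PU' * PU + e) + (PU' - PU + e)) + (N + 1) * PU * (s * PU) <=
  2 * (h * (N * PU)) + 4 * ((N * PU) * (Nb * h)) + 2 * (N * PU' - N * PU) + 4 * K1 * Zc +
  2 * (h * ((N * PU') * (N * PU))) + 2 * K3 * (Nb * Nb') + 2 * ((N * PU) * (h * (N * PU))).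
Proof.
move=> N1 h0 Nhh PU0 PUU' s1 sN Ns t0 tNb A_ge0 NA e0 Ne.
have N1N : N + 1 <= 2 * N by lra.
have N0 : 0 <= N + 1 by lra.
have PU'0 : 0 <= PU' by exact: le_trans PUU'.
have Nb0 : 0 <= Nb by exact: le_trans tNb.
have sP : s * PU <= h * (N * PU).
  by rewrite mulrA [h * N]mulrC ler_wpM2r.
have NP0 : 0 <= (N + 1) * PU by rewrite mulr_ge0.
have NP : (N + 1) * PU <= 2 * (N * PU) by rewrite mulrA ler_wpM2r.
have ts : t / s <= 2 * (Nb * h).
  rewrite ler_pdivrMr; last by lra.
  apply: le_trans tNb _; rewrite (_ : 2 * (Nb * h) * s = Nb * (h * (2 * s))); last by ring.
  rewrite -[leLHS]mulr1 ler_wpM2l // -[leLHS]Nhh [leRHS]mulrC.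
  by apply: ler_wpM2r; [exact: ltW|lra].
have i2 : (N + 1) * PU * (t / s) <= 4 * ((N * PU) * (Nb * h)).
  rewrite (_ : 4 * _ = 2 * (N * PU) * (2 * (Nb * h))); last by ring.
  by apply: ler_pM => //; rewrite divr_ge0 //; lra.
have i3 : (N + 1) * (PU' - PU) <= 2 * (N * PU' - N * PU).
  rewrite (_ : 2 * _ = 2 * N * (PU' - PU)); last by ring.
  by rewrite ler_wpM2r // subr_ge0.
have i4 : (N + 1) * (s * e + e) <= 4 * K1 * Zc.
  apply: (@le_trans _ _ (4 * (N * (N * h) * e))); last by rewrite -mulrA; lra.
  rewrite (_ : 4 * _ = (2 * N) * (2 * (N * h) * e)); last by ring.
  apply: ler_pM => //; first by rewrite addr_ge0 // mulr_ge0 //; lra.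
  rewrite (_ : s * e + e = (s + 1) * e); last by ring.
  by rewrite ler_wpM2r //; lra.
have i5 : (N + 1) * (s * (PU' * PU)) <= 2 * (h * ((N * PU') * (N * PU))).
  apply: (@le_trans _ _ ((2 * N) * (N * h * (PU' * PU)))).
    apply: ler_pM => //; first by rewrite mulr_ge0 ?mulr_ge0 //; lra.
    by rewrite ler_wpM2r // mulr_ge0.
  by rewrite le_eqVlt; apply/orP; left; apply/eqP; ring.
have i6 : (N + 1) * (t * A) <= 2 * K3 * (Nb * Nb').
  apply: (@le_trans _ _ ((2 * N) * (Nb * A))).
    apply: ler_pM => //; first by rewrite mulr_ge0.
    by rewrite ler_wpM2r.
  rewrite (_ : 2 * N * _ = 2 * Nb * (N * A)); last by ring.
  rewrite (_ : 2 * K3 * _ = 2 * Nb * (K3 * Nb')); last by ring.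
  by rewrite ler_wpM2l // mulr_ge0.
have i7 : (N + 1) * PU * (s * PU) <= 2 * ((N * PU) * (h * (N * PU))).
  rewrite (_ : 2 * _ = 2 * (N * PU) * (h * (N * PU))); last by ring.
  by apply: ler_pM => //; rewrite mulr_ge0 //; lra.
lra.
Qed.

Section visit_limit.
Context {R : realType} {d1 d2 : measure_display}.
Context {X : borelMetricType R d1} {Y : borelMetricType R d2}.
Hypotheses (cX : compact [set: X]) (cY : compact [set: Y]).
Variables (T : X -> X) (u : X * Y -> Y) (nu : probability (X * Y)%type R).
Hypotheses (mT : measurable_fun setT T) (measurable_u : measurable_fun setT u).
Let F := skew_ext T u.
Hypothesis invF : invariant_measure nu F.
Variables (ahat C2 alpha : R) (Theta : nat -> R).
Hypotheses (ahat01 : 0 < ahat <= 1) (C2_gt0 : 0 < C2).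
Hypothesis decay : forall (Ups Psi : X * Y -> R), hoelder_continuous ahat Ups ->
  measurable_fun setT Psi -> ('N[nu]_+oo[EFin \o Psi] < +oo)%E ->
  forall j : nat, (1 <= j)%N ->
  `| \int[nu]_q (Psi (iter j F q) * Ups q) - (\int[nu]_q Ups q) * (\int[nu]_q Psi q) |
  <= C2 * Theta j * fine ('N[nu]_+oo[EFin \o Psi])%E * hoelder_norm ahat Ups.
Hypothesis Theta_le : forall j : nat, (1 <= j)%N -> Theta j <= j%:R `^ (- alpha).
Variables (D : nat) (g : nat -> R) (k1 gam b b' : R).
Hypotheses (D0 : (0 < D)%N) (k10 : 0 < k1).
Hypothesis g_ge : forall n : nat, (1 <= n)%N -> k1 * n%:R `^ (D%:R * gam) <= g n.
Hypotheses (b0 : 0 < b) (b_half : b < 2^-1) (bb' : b < b') (bgam : b < gam).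
Hypothesis b_alpha : 7 / 4 + D%:R^-1 < b * alpha.

Lemma measurable_skew_ext : measurable_fun setT F.
Proof.
by apply: measurable_fun_pair => //; exact: measurableT_comp.
Qed.

Variables (p : X * Y) (L : R).
Hypothesis density : prob nu (mball pdist p r) / r ^+ D @[r --> 0^'+] --> L.
Hypothesis short : exists2 r1 : R, 0 < r1 & \forall k \near \oo, forall r : R, 0 < r < r1 ->
  (nu (mball pdist p r `&` fst @^-1` short_return T g (2 ^ k)) <=
   ((2 ^ k)%:R `^ (- (D%:R * b')) * r ^+ D)%:E)%E.

Let near_pos : \forall n \near \oo, (0 < n)%N. Proof. by exists 1%N. Qed.

Let quarter_cvg (c : R) : 1 + c * n%:R `^ (- 4^-1) @[n --> \oo] --> (1 : R).
Proof.
rewrite -[X in _ --> X]addr0 -(mulr0 c); apply: cvgD; first exact: cvg_cst.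
by apply: cvgM; [exact: cvg_cst|exact: cvg_natpowRN].
Qed.

Lemma scaled_pcball_cvg (v c : R) : 0 <= c ->
  n%:R * prob nu (pcball p (radius_seq D v n * (1 + c * n%:R `^ (- 4^-1)))) @[n --> \oo]
    --> L * expR (- (D%:R * v)).
Proof.
move=> c0.
have pos e : 0 <= e -> \forall n \near \oo, 0 < 1 + e * n%:R `^ (- 4^-1) :> R.
  by move=> e0; apply: nearW => n; rewrite ltr_pwDl // mulr_ge0 ?powR_ge0.
have c10 : 0 <= c + 1 by rewrite addr_ge0.
have lo := scaled_cvg (v := v) D0 density (pos _ c0) (quarter_cvg c).
have hi := scaled_cvg (v := v) D0 density (pos _ c10) (quarter_cvg (c + 1)).
apply: (squeeze_cvgr _ lo hi); apply: filterS near_pos => n n0.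
have r0 := radius_seq_gt0 D v n0.
have mc := measurable_pcball p (radius_seq D v n * (1 + c * n%:R `^ (- 4^-1))).
have n00 : 0 <= n%:R :> R by [].
have q0 : 0 < n%:R `^ (- 4^-1) :> R by rewrite powR_gt0 // ltr0n.
apply/andP; split; apply: ler_wpM2l => //; apply: prob_le => //; try exact: measurable_pball.
  by move=> q; exact: ltW.
move=> q /= qc; apply: le_lt_trans qc _.
by rewrite ltr_pM2l // ltrD2l ltr_pM2r // ltrDl.
Qed.

Theorem visit_limit (v : R) :
  nu [set q | (Zmax F p n q < (v + D%:R^-1 * ln n%:R)%:E)%E] @[n --> \oo] -->
  (expR (- (L * expR (- (D%:R * v)))))%:E.
Proof.
set tau := L * _.
pose r n := radius_seq D v n; pose w n := r n * n%:R `^ (- 4^-1).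
pose U n := pcball p (r n); pose U' n := pcball p (r n + w n).
pose x n : R := n%:R * prob nu (U n); pose x' n : R := n%:R * prob nu (U' n).
have mU n : measurable (U n) by exact: measurable_pcball.
have mU' n : measurable (U' n) by exact: measurable_pcball.
have mF := measurable_skew_ext.
have xtau : x n @[n --> \oo] --> tau.
  have := scaled_pcball_cvg (v := v) (lexx 0).
  apply: cvg_trans; apply: near_eq_cvg; apply: nearW => n.
  by rewrite mul0r addr0 mulr1.
have x'tau : x' n @[n --> \oo] --> tau.
  have := scaled_pcball_cvg (v := v) (@ler01 R).
  apply: cvg_trans; apply: near_eq_cvg; apply: nearW => n.
  by rewrite mul1r mulrDr mulr1.
have D0R : 0 < D%:R :> R by rewrite ltr0n.
have DV0 : 0 < D%:R^-1 :> R by rewrite invr_gt0.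
have alpha0 : 0 < alpha.
  by rewrite -(pmulr_rgt0 _ b0); apply: lt_trans b_alpha; lra.
have a_gt0 : 0 < 2^-1 - b by rewrite subr_gt0.
have c_gt0 : 0 < b * alpha - 7 / 4 - D%:R^-1 by rewrite -addrA -opprD subr_gt0.
have e_gt0 : 0 < b' - b by rewrite subr_gt0.
have [r1 r10 [k0 _ hk0]] := short.
have radius0 := radius_seq_cvg0 v D0.
pose K3 : R := (expR v / 8) `^ (- (D%:R * b')) * 2 ^+ D * expR (- (D%:R * v)).
pose K1 : R := C2 * 2^-1 `^ (- alpha) * 2 * expR v.
have err0 := error_cvg0 (4 * K1) (2 * K3) xtau x'tau a_gt0 c_gt0 e_gt0.
pose Err n : R := 2 * (n%:R `^ (- 2^-1) * x n) + 4 * (x n * n%:R `^ (- (2^-1 - b))) +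
  2 * (x' n - x n) + 4 * K1 * n%:R `^ (- (b * alpha - 7 / 4 - D%:R^-1)) +
  2 * (n%:R `^ (- 2^-1) * (x' n * x n)) + 2 * K3 * n%:R `^ (- (b' - b)) +
  2 * (x n * (n%:R `^ (- 2^-1) * x n)).
have small (z : nat -> R) (e : R) : z n @[n --> \oo] --> 0 -> 0 < e ->
    \forall n \near \oo, z n < e.
  move=> z0 e0; have : \forall n \near \oo, `|0 - z n| < e by move: z0 => /cvgr_dist_lt; exact.
  by apply: filterS => n; rewrite sub0r normrN; apply: le_lt_trans; exact: ler_norm.
have near_r1 : \forall n \near \oo, r n < r1 / 2 by apply: small => //; rewrite divr_gt0.
have near_k0 : \forall n \near \oo, r n < (4 * (2 ^ k0)%:R)^-1.
  by apply: small => //; rewrite invr_gt0 mulr_gt0 // ltr0n expn_gt0.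
have near_w : \forall n \near \oo, w n < 1.
  apply: small => //; rewrite -(mulr0 0); apply: cvgM => //.
  by apply: cvg_natpowRN; rewrite invr_gt0.
have A0 : 0 < k1 * (expR v / 8) `^ (D%:R * gam).
  by rewrite mulr_gt0 // powR_gt0 // divr_gt0 // expR_gt0.
have near_g : \forall n \near \oo, n%:R `^ (- (gam - b)) < k1 * (expR v / 8) `^ (D%:R * gam).
  by apply: small => //; apply: cvg_natpowRN; rewrite subr_gt0.
have near_s : \forall n \near \oo, n%:R `^ (- 2^-1) * x n < 1.
  apply: small => //; rewrite -(mul0r tau); apply: cvgM => //.
  by apply: cvg_natpowRN; rewrite invr_gt0.
have main : \forall n \near \oo,
    `|prob nu (no_visit F (U n) n.+1) - expR (- (n.+1%:R * prob nu (U n)))| <= Err n.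
  near=> n.
  have n0 : (0 < n)%N by near: n.
  have hw1 : w n < 1 by near: n.
  have hk1 : r n < (4 * (2 ^ k0)%:R)^-1 by near: n.
  have hg1 : n%:R `^ (- (gam - b)) < k1 * (expR v / 8) `^ (D%:R * gam) by near: n.
  have hr1 : r n < r1 / 2 by near: n.
  have hs1 : n%:R `^ (- 2^-1) * x n < 1 by near: n.
  pose N : R := n%:R.
  have N1 : 1 <= N by rewrite ler1n.
  have N_gt0 : 0 < N by exact: lt_le_trans N1.
  have NneQ : N != 0 by rewrite gt_eqF.
  have pD (e f : R) : N `^ (e + f) = N `^ e * N `^ f by rewrite powRD // NneQ implybT.
  have p1 : N `^ 1 = N by rewrite powRr1 // ltW.
  have pge1 (e : R) : 0 <= e -> 1 <= N `^ e by move=> e0; rewrite -[leLHS](powRr0 N) ler_powR.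
  have anti (a c e : R) : 0 < a -> a <= c -> 0 <= e -> c `^ (- e) <= a `^ (- e).
    move=> a0 ac e0; have c0 := lt_le_trans a0 ac.
    rewrite !powRN lef_pV2 ?posrE ?powR_gt0 //.
    by apply: ge0_ler_powR => //; rewrite nnegrE; exact: ltW.
  set h : R := N `^ (- 2^-1).
  have h0 : 0 < h by rewrite powR_gt0.
  have Nh : N * h = N `^ 2^-1 by rewrite -{1}p1 -pD; congr (_ `^ _); lra.
  have Nhh : N * h * h = 1 by rewrite Nh -pD subrr powRr0.
  pose rn := r n; pose wn := w n.
  have rn0 : 0 < rn by exact: radius_seq_gt0.
  have wn0 : 0 < wn by rewrite mulr_gt0 // powR_gt0.
  have wn1 : wn <= 1 by exact: ltW.
  have rV : rn^-1 = expR v * N `^ D%:R^-1.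
    by rewrite /rn /r /radius_seq expRN powRN invfM !invrK.
  have S1 : 1 <= N * h by rewrite Nh; apply: pge1; rewrite invr_ge0.
  pose Nb := N `^ b.
  have Nb1 : 1 <= Nb by apply: pge1; exact: ltW.
  have [s [s1 sS Ss smax]] := nat_floor_half S1.
  have [t [t1 tNb Nbt _]] := nat_floor_half Nb1.
  have ts : (t <= s)%N.
    by apply: smax; apply: le_trans tNb _; rewrite Nh; apply: ler_powR => //; exact: ltW.
  have s1R : 1 <= s%:R :> R by rewrite ler1n.
  have rn4 : 0 < 4 * rn by exact: mulr_gt0.
  pose y := (4 * rn)^-1.
  have k0y : (2 ^ k0)%:R <= y.
    have rk : rn < (4 * (2 ^ k0)%:R)^-1 by exact: hk1.
    have k2 : 0 < (2 ^ k0)%:R :> R by rewrite ltr0n expn_gt0.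
    rewrite /y -[leLHS]invrK lef_pV2 ?posrE ?invr_gt0 //.
    by rewrite mulrC -ler_pdivlMr // mulrC -invfM ltW.
  have y1 : 1 <= y by apply: le_trans k0y; rewrite ler1n expn_gt0.
  have y0 : 0 < y by exact: lt_le_trans y1.
  have [k [Ky yK /(_ _ k0y) k0k]] := dyadic_floor_half y1.
  have K0 : 0 < (2 ^ k)%:R :> R by rewrite ltr0n expn_gt0.
  have rK : 2 * rn < (2 ^ k)%:R^-1.
    apply: (@lt_le_trans _ _ (4 * rn)); first by rewrite ltr_pM2r // ltr_nat.
    by rewrite -[leLHS]invrK lef_pV2 ?posrE ?invr_gt0.
  have yE : y / 2 = expR v / 8 * N `^ D%:R^-1.
    by rewrite /y invfM rV; field.
  have v8 : 0 < expR v / 8 by rewrite divr_gt0 // expR_gt0.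
  have NDpow (e : R) : (y / 2) `^ e = (expR v / 8) `^ e * N `^ (D%:R^-1 * e).
    by rewrite yE powRM ?powR_ge0 ?ltW // powRrM.
  have DD (e : R) : D%:R^-1 * (D%:R * e) = e by rewrite mulKf // gt_eqF.
  have y20 : 0 < y / 2 by rewrite divr_gt0.
  have tg : t%:R <= g (2 ^ k)%N.
    apply: le_trans tNb _; apply: le_trans (g_ge _); last by rewrite expn_gt0.
    have yg : (y / 2) `^ (D%:R * gam) <= (2 ^ k)%:R `^ (D%:R * gam).
      apply: ge0_ler_powR; rewrite ?nnegrE ?(ltW y20) ?(ltW K0) ?mulr_ge0 //.
      by apply: ltW; apply: lt_trans bgam.
    apply: le_trans (ler_wpM2l (ltW k10) yg).
    rewrite NDpow DD mulrA.
    rewrite (_ : Nb = N `^ (- (gam - b)) * N `^ gam); last by rewrite -pD; congr (_ `^ _); ring.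
    by apply: ler_wpM2r; [exact: powR_ge0|exact: ltW].
  pose A : R := (2 ^ k)%:R `^ (- (D%:R * b')) * (2 * rn) ^+ D.
  have A_ge0 : 0 <= A by rewrite mulr_ge0 ?powR_ge0 // exprn_ge0 // mulr_ge0 // ltW.
  have mE : measurable (fst @^-1` short_return T g (2 ^ k) : set (X * Y)).
    rewrite -[_ @^-1` _]setTI; apply: measurable_fst => //.
    exact: measurable_short_return.
  have shortA j : (1 <= j <= t)%N -> prob nu (U n `&` (iter j F @^-1` U n)) <= A.
    move=> /andP[j1 jt].
    have jg : j%:R <= g (2 ^ k)%N by apply: le_trans tg; rewrite ler_nat.
    have sub := return_short (u := u) (p := p) cX cY j1 jg rK.
    have mj : measurable (iter j F @^-1` U n) by exact: measurable_preiter.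
    have mb : measurable (mball pdist p (2 * rn)) by exact: measurable_pball.
    apply: (@le_trans _ _ (prob nu
      (mball pdist p (2 * rn) `&` fst @^-1` short_return T g (2 ^ k)))).
      apply: prob_le; [exact: measurableI|exact: measurableI|].
      move=> q /sub [qr qE]; split => //; apply: le_lt_trans qr _.
      by rewrite -/rn; lra.
    rewrite /prob -lee_fin fineK ?fin_num_measure //; last exact: measurableI.
    apply: hk0 => //; rewrite mulr_gt0 //=.
    by move: hr1; rewrite ltr_pdivlMr // mulrC.
  have NA : N * A <= K3 * N `^ (- b').
    have b'0 : 0 <= D%:R * b' by rewrite mulr_ge0 // ltW // (lt_trans b0).
    have cK : (2 ^ k)%:R `^ (- (D%:R * b')) <= (expR v / 8) `^ (- (D%:R * b')) * N `^ (- b').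
      by apply: le_trans (anti _ _ _ y20 yK b'0) _; rewrite NDpow mulrN DD.
    have NrD : N * rn ^+ D = expR (- (D%:R * v)) by exact: radius_seq_expn.
    rewrite (_ : N * A = (2 ^ k)%:R `^ (- (D%:R * b')) * (2 ^+ D * (N * rn ^+ D))); last first.
      by rewrite /A exprMn; ring.
    rewrite NrD (_ : K3 * _ = (expR v / 8) `^ (- (D%:R * b')) * N `^ (- b') *
      (2 ^+ D * expR (- (D%:R * v)))); last by rewrite /K3; ring.
    by rewrite ler_wpM2r // mulr_ge0 ?exprn_ge0 ?ltW ?expR_gt0.
  pose e : R := C2 * t%:R `^ (- alpha) * (2 / wn).
  have e0 : 0 <= e by rewrite !mulr_ge0 ?powR_ge0 ?invr_ge0 // ltW.
  pose Zc := N `^ (- (b * alpha - 7 / 4 - D%:R^-1)).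
  have Ne : N * (N * h) * e <= K1 * Zc.
    have tal : t%:R `^ (- alpha) <= 2^-1 `^ (- alpha) * N `^ (- (b * alpha)).
      apply: le_trans (anti (Nb / 2) _ _ _ Nbt (ltW alpha0)) _.
        by rewrite divr_gt0 // (lt_le_trans ltr01).
      by rewrite powRM ?powR_ge0 ?invr_ge0 // mulrC -powRrM mulrN.
    have wV : wn^-1 = expR v * N `^ D%:R^-1 * N `^ 4^-1.
      by rewrite /wn /w invfM -/rn rV powRN invrK.
    have ZcE : Zc = N * (N * h) * N `^ (- (b * alpha)) * N `^ D%:R^-1 * N `^ 4^-1.
      rewrite Nh -{1}p1 -!pD /Zc; congr (_ `^ _).
      by set dv := D%:R^-1; lra.
    rewrite ZcE /e wV.
    have -> : K1 * (N * (N * h) * N `^ (- (b * alpha)) * N `^ D%:R^-1 * N `^ 4^-1) =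
      (2^-1 `^ (- alpha) * N `^ (- (b * alpha))) *
      (C2 * 2 * expR v * (N * (N * h)) * N `^ D%:R^-1 * N `^ 4^-1) by rewrite /K1; ring.
    have -> : N * (N * h) * (C2 * t%:R `^ (- alpha) * (2 * (expR v * N `^ D%:R^-1 * N `^ 4^-1))) =
      t%:R `^ (- alpha) * (C2 * 2 * expR v * (N * (N * h)) * N `^ D%:R^-1 * N `^ 4^-1) by ring.
    apply: ler_wpM2r => //.
    by rewrite !mulr_ge0 ?powR_ge0 ?expR_ge0 // ltW.
  have wn01 : 0 < wn <= 1 by rewrite wn0.
  have decor W j : measurable W -> (t <= j)%N ->
     prob nu (U n) * prob nu W - (prob nu (U' n) - prob nu (U n)) - e <=
     prob nu (U n `&` (iter j F @^-1` W)) <= prob nu (U' n) * prob nu W + e.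
    move=> mW tj; have j1 : (1 <= j)%N by exact: leq_trans tj.
    have /andP[d1' d2'] := decorrelation cX cY mF ahat01 C2_gt0 decay Theta_le p rn wn01 mW j1.
    have ej : C2 * j%:R `^ (- alpha) * (2 / wn) <= e.
      rewrite /e ler_wpM2r ?divr_ge0 ?(ltW wn0) // ler_wpM2l ?(ltW C2_gt0) //.
      by apply: anti; rewrite ?ltr0n ?ler_nat // ltW.
    by apply/andP; split; move: d1' d2' ej; rewrite -/(U n) -/(U' n); lra.
  have PU0 := prob_ge0 nu (U n); have PU'0 := prob_ge0 nu (U' n).
  have PUU' : prob nu (U n) <= prob nu (U' n).
    by apply: prob_le => // q /= hq; apply: le_trans hq _; rewrite lerDl ltW.
  have mix m j : (t <= j)%N ->
      `|prob nu (U n `&` (iter j F @^-1` no_visit F (U n) m)) -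
        prob nu (U n) * prob nu (no_visit F (U n) m)| <= prob nu (U' n) - prob nu (U n) + e.
    move=> tj; have mW := measurable_no_visit mF (mU n) m.
    have /andP[l1 l2] := decor _ _ mW tj.
    have W0 := prob_ge0 nu (no_visit F (U n) m); have W1 := prob_le1 nu mW.
    rewrite ler_norml; apply/andP; split; first by lra.
    have : (prob nu (U' n) - prob nu (U n)) * prob nu (no_visit F (U n) m) <=
       prob nu (U' n) - prob nu (U n) by rewrite ler_piMr // subr_ge0.
    lra.
  have sumP : \sum_(1 <= j < s) prob nu (U n `&` (iter j F @^-1` U n)) <=
      t%:R * A + s%:R * (prob nu (U' n) * prob nu (U n) + e).
    apply: sum_two_bounds => //; last by rewrite addr_ge0 // mulr_ge0.
    by move=> j tj; have /andP[] := decor _ _ (mU n) (ltnW tj).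
  have sU1 : s%:R * prob nu (U n) <= 1.
    move: hs1; rewrite /x -/N -/h => hx; apply: le_trans (ltW hx).
    by rewrite mulrA [h * N]mulrC ler_wpM2r.
  have eta0 : 0 <= prob nu (U' n) - prob nu (U n) + e by rewrite addr_ge0 // subr_ge0.
  apply: le_trans (no_visit_poisson mF invF (mU n) n.+1 s1 ts eta0 sU1 mix sumP) _.
  have -> : n.+1%:R = N + 1 by rewrite /N natr1.
  rewrite /Err -/N -/h -/Zc.
  have -> : N `^ (- (2^-1 - b)) = Nb * h by rewrite -pD; congr (_ `^ _); ring.
  have -> : N `^ (- (b' - b)) = Nb * N `^ (- b') by rewrite -pD; congr (_ `^ _); ring.
  exact: (error_bound N1 h0 Nhh PU0 PUU' s1R sS Ss (ler0n _ _) tNb A_ge0 NA e0 Ne).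
have xs : n.+1%:R * prob nu (U n) @[n --> \oo] --> tau.
  have : x n + n%:R^-1 * x n @[n --> \oo] --> tau + 0 * tau.
    by apply: cvgD => //; apply: cvgM => //; exact: cvg_natV.
  rewrite mul0r addr0; apply: cvg_trans; apply: near_eq_cvg.
  apply: filterS near_pos => n n0.
  rewrite /x mulrA mulVf ?mul1r; last by rewrite pnatr_eq0 -lt0n.
  by rewrite -natr1 mulrDl mul1r.
have es : expR (- (n.+1%:R * prob nu (U n))) @[n --> \oo] --> expR (- tau).
  by apply: (cvg_comp _ _ (cvgN xs)); exact: continuous_expR.
have diff : prob nu (no_visit F (U n) n.+1) - expR (- (n.+1%:R * prob nu (U n)))
    @[n --> \oo] --> 0.
  apply/cvgr0Pnorm_le => e e0.
  have se := small _ _ err0 e0; apply: filterS2 main se => n h1 h2.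
  by apply: le_trans h1 _; exact: ltW.
have lim : prob nu (no_visit F (U n) n.+1) @[n --> \oo] --> expR (- tau).
  rewrite (_ : (fun n => _) = (fun n => (prob nu (no_visit F (U n) n.+1) -
    expR (- (n.+1%:R * prob nu (U n)))) + expR (- (n.+1%:R * prob nu (U n))))).
    by rewrite -[X in _ --> X]add0r; exact: cvgD.
  by apply/funext => n; rewrite subrK.
have : (prob nu (no_visit F (U n) n.+1))%:E @[n --> \oo] --> (expR (- tau))%:E.
  by apply/fine_cvgP; split; [exact: nearW|exact: lim].
apply: cvg_trans; apply: near_eq_cvg; apply: filterS near_pos => n n0.
rewrite (Zmax_ltE cX cY) -radius_seqE // /prob fineK // fin_num_measure //.
by apply: measurable_no_visit.
Unshelve. all: by end_near. Qed.

End visit_limit.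

Section finite_product.
Context {R : realType} d1 d2 (X : measurableType d1) (Y : measurableType d2).
Variables (lamX : {finite_measure set X -> \bar R}) (lamY : {finite_measure set Y -> \bar R}).

(* The library's canonical structure on \x stops at sigma-finite measures. *)
Definition finite_prod : set (X * Y) -> \bar R := (lamX \x lamY)%E.

HB.instance Definition _ := Measure.on finite_prod.

Let finite_prod_fin : fin_num_fun finite_prod.
Proof.
apply: lty_fin_num_fun; rewrite [ltLHS](_ : _ = lamX setT * lamY setT)%E.
  by rewrite ltey_eq fin_numM // fin_num_measure.
rewrite -product_measure1E //; congr ((lamX \x lamY)%E _).
by rewrite setXTT.
Qed.

HB.instance Definition _ := Measure_isFinite.Build _ _ _ finite_prod finite_prod_fin.

End finite_product.

Lemma geometric_nneseries_lty {R : realType} (C z : R) : 0 <= C -> 0 < z -> z < 1 ->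
  (\sum_(k <oo) (C * z ^+ k)%:E < +oo)%E.
Proof.
move=> C0 z0 z1; apply: (@le_lt_trans _ _ (C * (1 - z)^-1)%:E); last exact: ltry.
apply: lime_le.
  by apply: is_cvg_nneseries => k _ _; rewrite lee_fin mulr_ge0 // exprn_ge0 // ltW.
apply: nearW => n; rewrite sumEFin lee_fin.
by apply: geometric_le_lim => //; rewrite gtr0_norm.
Qed.

Lemma has_density_ae {R : realType} d (Z : measurableType d) (nu lam : {measure set Z -> \bar R})
    (h : Z -> R) (P : Z -> Prop) : has_density nu lam h ->
  {ae lam, forall x, P x} -> {ae nu, forall x, P x}.
Proof.
move=> [ih nuE] [N [mN N0 PN]]; exists N; split => //.
rewrite nuE //; apply: null_set_integral => //.
exact: measurable_funTS (measurable_int _ ih).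
Qed.

Lemma ae_short_return {R : realType} (D : nat) (d1 d2 : measure_display)
  (X : borelMetricType R d1) (Y : borelMetricType R d2)
  (cX : compact [set: X]) (cY : compact [set: Y])
  (lam : {measure set (X * Y) -> \bar R})
  (reg : {ae lam, forall p, upper_regular (@pdist R d1 d2 X Y) lam D p})
  (nu : probability (X * Y)%type R)
  (T : X -> X) (mT : measurable_fun setT T) (g : nat -> R) (C beta c : R) :
  0 < C -> c < beta ->
  (forall n : nat, (1 <= n)%N ->
    (nu (fst @^-1` short_return T g n) <= (C / n%:R `^ beta)%:E)%E) ->
  {ae lam, forall p, exists2 r1 : R, 0 < r1 & \forall k \near \oo,
    forall r : R, 0 < r < r1 ->
    (nu (mball pdist p r `&` fst @^-1` short_return T g (2 ^ k)) <=
     ((2 ^ k)%:R `^ (- c) * r ^+ D)%:E)%E}.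
Proof.
move=> C0 cb hE.
have mE n : measurable (fst @^-1` short_return T g n : set (X * Y)).
  rewrite -[_ @^-1` _]setTI; apply: measurable_fst => //.
  exact: measurable_short_return.
have K0 k : 0 < (2 ^ k)%:R :> R by rewrite ltr0n expn_gt0.
pose sig k := mrestr nu (mE (2 ^ k)%N).
have BC := @maximal_borel_cantelli R _ _ _ (pdist_separable cX cY)
  (@measurable_pball R d1 d2 X Y) lam D sig (fun k => (2 ^ k)%:R `^ (- c))
  (fun k => powR_gt0 _ (K0 k)).
have {}BC := BC _; apply: filterS2 reg (BC _) => [p ur /(_ ur) //|].
pose z : R := 2 `^ (- (beta - c)).
have z0 : 0 < z by exact: powR_gt0.
have z1 : z < 1.
  have bc0 : 0 < beta - c by rewrite subr_gt0.
  have := gt0_ltr_powR bc0 (x := 1) (y := 2); rewrite powR1 ltr1n => lt2.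
  by rewrite /z powRN invf_lt1 ?powR_gt0 // lt2 ?nnegrE.
apply: le_lt_trans (geometric_nneseries_lty (ltW C0) z0 z1).
apply: lee_nneseries => [k _ _|k _].
  by rewrite mule_ge0 // lee_fin invr_ge0 powR_ge0.
rewrite -[X in (_ * X <= _)%E]/(nu (setT `&` fst @^-1` short_return T g (2 ^ k))) setTI.
have k1 : (1 <= 2 ^ k)%N by rewrite expn_gt0.
apply: (le_trans (lee_wpmul2l _ (hE _ k1))); first by rewrite lee_fin invr_ge0 powR_ge0.
rewrite -EFinM lee_fin le_eqVlt; apply/orP; left; apply/eqP.
have Kne : (2 ^ k)%:R != 0 :> R by rewrite gt_eqF.
have -> : z ^+ k = (2 ^ k)%:R `^ (- (beta - c)).
  by rewrite -[LHS]powR_mulrn ?powR_ge0 // -powRrM mulrC powRrM powR_mulrn // natrX.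
rewrite powRN invrK opprB powRB ?Kne ?implybT //.
by rewrite mulrCA.
Qed.

Lemma block_exponents {R : realType} (d kappa gam alpha : R) : 0 <= d -> 1 < kappa ->
  0 < gam -> (d + kappa * (3 / 2) + 1 / 2) / Num.min gam (1 / 2) < alpha ->
  exists b, [/\ 0 < b, b < 2^-1, b < gam & 7 / 4 + d < b * alpha].
Proof.
move=> d0 kap gam0; set m := Num.min _ _.
have m0 : 0 < m by rewrite lt_min gam0 /=; lra.
have mg : m <= gam by rewrite ge_min lexx.
have mh : m <= 1 / 2 by rewrite ge_min lexx orbT.
rewrite ltr_pdivrMr // => hm.
have alpha0 : 0 < alpha by rewrite -(pmulr_lgt0 _ m0); apply: lt_trans hm; lra.
have mam : (7 / 4 + d) / alpha < m by rewrite ltr_pdivrMr // mulrC; lra.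
have q0 : 0 < (7 / 4 + d) / alpha by rewrite divr_gt0 //; lra.
exists (((7 / 4 + d) / alpha + m) / 2); split; try lra.
have : (7 / 4 + d) / alpha < ((7 / 4 + d) / alpha + m) / 2 by lra.
by rewrite ltr_pdivrMr.
Qed.

Theorem theorem2p1 (R : realType) (N M : nat) (d1 d2 : measure_display)
  (X : borelMetricType R d1) (Y : borelMetricType R d2)
  (* X and Y are compact Riemannian manifolds, Y is connected *)
  (GX : riemannian R N X) (GY : riemannian R M Y)
  (hdX : riemannian_distance GX) (hdY : riemannian_distance GY)
  (cX : compact [set: X]) (cY : compact [set: Y])
  (connY : connected [set: Y])
  (* normalized Lebesgue measures *)
  (lamX : {finite_measure set X -> \bar R})
  (lamY : {finite_measure set Y -> \bar R})
  (hlamX : lebesgue_on GX lamX) (hlamY : lebesgue_on GY lamY)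
  (hlam : {ae (lamX \x lamY)%E, forall p : X * Y,
    fine ((lamX \x lamY)%E (pball p r)) / r ^+ (M + N) @[r --> 0^'+] --> (1 : R)})
  (* dynamics *)
  (T : X -> X) (u : X * Y -> Y)
  (meas_T : measurable_fun setT T) (meas_u : measurable_fun setT u)
  (muX : probability X R)
  (invX : invariant_measure muX T) (ergX : ergodic muX T)
  (suppX : full_support muX)
  (nu : probability (X * Y)%type R)
  (invnu : invariant_measure nu (skew_ext T u))
  (h : X * Y -> R) (hh : has_density nu (muX \x lamY)%E h)
  (H : X * Y -> R) (hH : has_density nu (lamX \x lamY)%E H)
  (delta kappa : R) (delta0 : 0 < delta)
  (HLp : locally_Lp (lamX \x lamY)%E (1 + delta) H)
  (kappa1 : 1 < kappa) (conj : (1 + delta)^-1 + kappa^-1 = 1)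
  (* hypothesis (a) *)
  (C1 beta gamma' : R) (C1_gt0 : 0 < C1) (beta_gt0 : 0 < beta)
  (gamma_gt0 : 0 < gamma') (gamma_lt : gamma' < beta / (M + N)%:R)
  (g : nat -> R) (g_incr : {homo g : m n / (m <= n)%N >-> m <= n})
  (g_approx : exists k1 k2 : R, [/\ 0 < k1, 0 < k2 & forall n : nat, (1 <= n)%N ->
     k1 * n%:R `^ ((M + N)%:R * gamma') <= g n <= k2 * n%:R `^ ((M + N)%:R * gamma')])
  (hE : forall n : nat, (1 <= n)%N ->
     (muX (short_return T g n) < (C1 / n%:R `^ beta)%:E)%E)
  (* hypothesis (b) *)
  (ahat C2 alpha : R) (Theta : nat -> R)
  (ahat_gt0 : 0 < ahat) (ahat_le1 : ahat <= 1) (C2_gt0 : 0 < C2)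
  (decay : forall (Ups Psi : X * Y -> R), hoelder_continuous ahat Ups ->
     measurable_fun setT Psi -> ('N[nu]_+oo[EFin \o Psi] < +oo)%E ->
     forall j : nat, (1 <= j)%N ->
     `| \int[nu]_q (Psi (iter j (skew_ext T u) q) * Ups q)
        - (\int[nu]_q Ups q) * (\int[nu]_q Psi q) |
     <= C2 * Theta j * fine ('N[nu]_+oo[EFin \o Psi])%E * hoelder_norm ahat Ups)
  (Theta_le : forall j : nat, (1 <= j)%N -> Theta j <= j%:R `^ (- alpha))
  (alpha_gt : ((M + N)%:R^-1 * (1 + (M + N)%:R * kappa * (3 / 2 - kappa^-1)) + 3 / 2)
     / Num.min gamma' (1 / 2) < alpha) :
  {ae nu, forall p : X * Y, forall v : R,
    nu [set q | (Zmax (skew_ext T u) p n q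
                 < (v + (M + N)%:R^-1 * ln n%:R)%:E)%E] @[n --> \oo]
    --> (expR (- (H p * expR (- ((M + N)%:R * v)))))%:E}.
Proof.
pose D := (M + N)%N.
have D0 : (0 < D)%N.
  rewrite lt0n; apply/eqP => DE; move: gamma_lt; rewrite -/D DE invr0 mulr0.
  by rewrite ltNge (ltW gamma_gt0).
have DR : 0 < D%:R :> R by rewrite ltr0n.
have [k1 [k2 [k10 _ gk]]] := g_approx.
have [b [b0 bh bg balpha]] : exists b,
    [/\ 0 < b, b < 2^-1, b < gamma' & 7 / 4 + D%:R^-1 < b * alpha].
  apply: (block_exponents (kappa := kappa)) => //.
  move: alpha_gt; rewrite -/D; congr (_ / _ < _).
  have kne : kappa != 0 by rewrite gt_eqF // (lt_trans ltr01).
  by field; rewrite kne gt_eqF.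
pose b' := (b + gamma') / 2.
have bb' : b < b' by rewrite /b'; lra.
have Db' : D%:R * b' < beta.
  by move: gamma_lt; rewrite ltr_pdivlMr // mulrC; apply: lt_trans; rewrite ltr_pM2l // /b'; lra.
have rhoP := pdist_separable cX cY.
have mpball := @measurable_pball R d1 d2 X Y.
pose lam : {finite_measure set (X * Y)%type -> \bar R} := finite_prod lamX lamY.
have reg := @ae_upper_regular R _ _ _ mpball lam (M + N) hlam.
have diff := @density_differentiation R _ _ _ rhoP mpball
  (@prod_measurable_generated R d1 d2 X Y) lam (M + N) hlam nu H hH.
have marg n : (1 <= n)%N -> (nu (fst @^-1` short_return T g n) <= (C1 / n%:R `^ beta)%:E)%E.
  move=> n1; apply: le_trans (ltW (hE n n1)).
  apply: (skew_marginal_le meas_T invX ergX invnu hh).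
  exact: measurable_short_return.
have short := ae_short_return cX cY reg meas_T C1_gt0 Db' marg.
apply: (has_density_ae hH); apply: filterS2 diff short => p dp sp v.
have ah : 0 < ahat <= 1 by rewrite ahat_gt0.
apply: (visit_limit cX cY meas_T meas_u invnu ah C2_gt0 decay Theta_le D0 k10 _
  b0 bh bb' bg balpha dp sp).
by move=> n n1; have /andP[] := gk n n1.
Qed.
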